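(* Let $X_1,X_2,\ldots$ be independent real random variables with common probability density $f$. Assume: (P1) $L\in L^1(\mathbb{R})$, $\int_{\mathbb{R}}L(u)\,du=1$, and the weak second derivative $L''$ belongs to $L^1(\mathbb{R})\cap L^2(\mathbb{R})$; (P2) the function $G_L(z)=\int_{\mathbb{R}}L''(y)L''(y+z)\,dy$ belongs to $L^1(\mathbb{R})\cap L^2(\mathbb{R})$; (P3) $f$ is bounded and has weak second derivative $f''\in L^2(\mathbb{R})$, with $R(f'')>0$; (P4) the deterministic pilot bandwidth $b=b_n>0$ satisfies $b_n\to0$, $nb_n^4\to\infty$ and $n^2b_n^9\to\infty$. Then $$\widehat R_b^{U}:=\frac{1}{n(n-1)b^5}\sum_{1\le i\ne j\le n}G_L\left(\frac{X_i-X_j}{b}\right)\xrightarrow{p}R(f''),$$ and consequently $\widehat R_b^{U}/R(f'')\xrightarrow{p}1$. Suppose in addition that $f\in L^2(\mathbb{R})$ and that $K:\mathbb{R}\to\mathbb{R}$ satisfies $K\in L^1(\mathbb{R})\cap L^2(\mathbb{R})$, $\int K(u)\,du=1$, $\int uK(u)\,du=0$, $\int u^2|K(u)|\,du<\infty$, and $\mu_2(K)\ne0$. Then for any deterministic $\tau_n>0$ with $\tau_n\downarrow0$ and $\tau_n/R(f'')\to0$, the truncated bandwidth $$\widehat h_{\operatorname{GCPI}}=\left\{\frac{R(K)}{\mu_2(K)^2\,\max\{\widehat R_b^{U},\tau_n\}\,n}\right\}^{1/5}$$ is oracle-equivalent, i.e. $$\frac{\widehat h_{\operatorname{GCPI}}}{h_{\operatorname{AMISE}}}\xrightarrow{p}1\qquad\text{and}\qquad\frac{\operatorname{AMISE}(\widehat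 f_{\widehat h_{\operatorname{GCPI}}})}{\operatorname{AMISE}(\widehat f_{h_{\operatorname{AMISE}}})}\xrightarrow{p}1 .$$
   Context: Notation: $\mu_2(K)=\int_{\mathbb{R}}u^2K(u)\,du$; $R(g)=\int_{\mathbb{R}}g(x)^2\,dx$; $\xrightarrow{p}$ is convergence in probability as $n\to\infty$. A function $g\in L^1_{\mathrm{loc}}(\mathbb{R})$ is the weak second derivative of $f$, written $g=f''$, if $\int g\varphi\,dx=\int f\varphi''\,dx$ for every smooth compactly supported $\varphi$ (similarly for $L''$). For $h>0$ and sample size $n$, $\operatorname{AMISE}(\widehat f_h)=\frac{h^4}{4}\mu_2(K)^2R(f'')+\frac{R(K)}{nh}$, regarded as a function of $h$ into which a (possibly random) bandwidth may be substituted, and $h_{\operatorname{AMISE}}=\left(\frac{R(K)}{\mu_2(K)^2R(f'')\,n}\right)^{1/5}$ is its minimizer. *)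

(* Defs.v *)
From HB Require Import structures.
From mathcomp Require Export all_boot all_order all_algebra.
From mathcomp Require Export finmap.
From mathcomp Require Export all_classical all_reals all_analysis.
Export numFieldNormedType.Exports.

Set Implicit Arguments.
Unset Strict Implicit.
Unset Printing Implicit Defensive.

Import Order.TTheory GRing.Theory Num.Theory.
Local Open Scope classical_set_scope.
Local Open Scope ring_scope.

Section WeakDerivative.
Context {R : realType}.
Implicit Types f g phi : R -> R.

Definition test_function phi : Prop :=
  (forall (n : nat) (x : R), derivable (derive1n n phi) x 1) /\
  compact (closure [set x | phi x != 0]).

Definition weak_derive2 f g : Prop :=
  [/\ locally_integrable setT f, locally_integrable setT g &
    forall phi, test_function phi ->
      \int[lebesgue_measure]_x (g x * phi x) =
      \int[lebesgue_measure]_x (f x * derive1n 2 phi x)].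

End WeakDerivative.

Section Functionals.
Context {R : realType}.
Implicit Types f g K : R -> R.

(* R(g) in the literature. *)
Definition roughness g : R := \int[lebesgue_measure]_x (g x ^+ 2).

Definition mu2 K : R := \int[lebesgue_measure]_u (u ^+ 2 * K u).

(* G_L when g = L''. *)
Definition autocorrelation g (z : R) : R :=
  \int[lebesgue_measure]_y (g y * g (y + z)).

Definition AMISE K ddf (n : nat) (h : R) : R :=
  h ^+ 4 / 4 * mu2 K ^+ 2 * roughness ddf + roughness K / (n%:R * h).

(* The AMISE-optimal bandwidth as a function of the value r used for R(f''):
   r = R(f'') gives h_AMISE, an estimate of R(f'') gives a plug-in bandwidth. *)
Definition bandwidth K (r : R) (n : nat) : R :=
  (roughness K / (mu2 K ^+ 2 * r * n%:R)) `^ 5^-1.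

Definition h_AMISE K ddf (n : nat) : R := bandwidth K (roughness ddf) n.

End Functionals.

Section Probability.
Context d (T : measurableType d) (R : realType) (P : probability T R).

Definition mutually_independent (X : nat -> {RV P >-> R}) : Prop :=
  forall (J : {fset nat}) (A : nat -> set R),
    (forall i, i \in J -> measurable (A i)) ->
    P (\bigcap_(i in [set` J]) (X i @^-1` A i)) =
    (\prod_(i <- J) P (X i @^-1` A i))%E.

Definition has_density (X : {RV P >-> R}) (f : R -> R) : Prop :=
  [/\ measurable_fun setT f, (forall x, 0 <= f x) &
    forall A : set R, measurable A ->
      distribution P X A = (\int[lebesgue_measure]_(x in A) (f x)%:E)%E].

(* Measurability is part of the definition because P is unconstrained on
   nonmeasurable sets. *)
Definition cvg_in_probability (Y : nat -> T -> R) (c : R) : Prop :=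
  (forall n, measurable_fun setT (Y n)) /\
  (forall eps : R, 0 < eps ->
    (fun n => P [set w | eps < `|Y n w - c|]) @ \oo --> 0%E).

(* The sample of size n is X 0, ..., X n.-1; the values at n = 0, 1, where the
   prefactor is a division by zero, are irrelevant to limits. *)
Definition RU (ddL : R -> R) (X : nat -> {RV P >-> R}) (b : nat -> R)
    (n : nat) (w : T) : R :=
  (n%:R * (n%:R - 1) * b n ^+ 5)^-1 *
  \sum_(i < n) \sum_(j < n | j != i)
    autocorrelation ddL ((X i w - X j w) / b n).

Definition h_GCPI (K ddL : R -> R) (X : nat -> {RV P >-> R})
    (b tau : nat -> R) (n : nat) (w : T) : R :=
  bandwidth K (Num.max (RU ddL X b n w) (tau n)) n.

End Probability.

(* Main.v *)
From Pilot Require Import Defs.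
From mathcomp Require Import all_boot all_order all_algebra.
From mathcomp Require Import all_classical all_reals all_analysis.
From mathcomp Require Import measurable_realfun.
From mathcomp Require Import ring lra zify.
Import Order.TTheory GRing.Theory Num.Theory.
Import numFieldNormedType.Exports.
Set Implicit Arguments.
Unset Strict Implicit.
Unset Printing Implicit Defensive.
Local Open Scope classical_set_scope.
Local Open Scope ring_scope.

(** Write [corr c k u] for the function s |-> int k(t) u(s + c t) dt, which
    smooths u by k at scale c, and G for the autocorrelation of L''.

    Mean. The function G is itself the correlation of L'' with L'', so the mean of
    G((X - Y) / b) over two independent observations is b times the squared L2 norm
    of [corr b L'' f] ([Rintegral2_autocorrelation]). Two integrations by parts move
    the derivatives onto the density: [corr b L'' f] is b^2 [corr b L f'']
    ([roughness_corr_weak]). The mean of the pilot estimator is therefore exactly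
    R([corr b L f'']). As L has integral 1 and translations are continuous in L2,
    [corr b L f''] tends to f'' in L2 ([corr_approx_identity]), and the mean tends
    to R(f'').

    Variance. The square of the centred double sum expands over pairs of index
    pairs. Disjoint pairs are uncorrelated. Pairs with one common index contribute
    at most the second moment of the projection h(x) = E G((x - X) / b), and equal
    pairs at most the second moment of the kernel itself
    ([ustatistic_second_moment]). The bound on f replaces the law of X by Lebesgue
    measure. The kernel then has second moment O(b), since G is in L2
    ([kernel_second_moment_le]). The projection is b [corr (-b) L'' (corr b L'' f)],
    and Young's inequality together with the identity for [corr b L'' f] makes its
    second moment O(b^6) rather than O(b^2) ([kernel_projection_le]); this gain is
    where the smoothness of f enters the variance. After division by the square of
    n(n - 1)b^5 the two contributions are O(1 / (n b^4)) and O(1 / (n^2 b^9)), so the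
    pilot estimator converges in mean square, hence in probability.

    Bandwidth. Where the pilot estimator is close to R(f'') and n is large, the
    truncation is inactive. The ratio rho of the plug-in bandwidth to the optimal one
    is then the fifth root of R(f'') over the estimate. The AMISE at rho times its
    minimizer is (rho^4 + 4 / rho) / 5 times its minimum ([AMISE_ratio]), and this
    factor is continuous at rho = 1. Both claims follow by a continuous mapping
    argument. *)

(** * Iterated integrals of real-valued functions *)

Section RealFubini.
Context d1 d2 (T1 : measurableType d1) (T2 : measurableType d2) (R : realType).
Variable m1 : {sigma_finite_measure set T1 -> \bar R}.
Variable m2 : {sigma_finite_measure set T2 -> \bar R}.
Implicit Type F : T1 * T2 -> R.

Lemma measurable_Rintegral F : measurable_fun setT F ->
  measurable_fun setT (fun x => \int[m2]_y F (x, y)).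
Proof.
move=> mF.
have mG : measurable_fun [set: T1 * T2] (EFin \o F) by exact/measurable_EFinP.
have E x : (\int[m2]_y (F (x, y))%:E =
    \int[m2]_y ((EFin \o F)^\+)%E (x, y) - \int[m2]_y ((EFin \o F)^\-)%E (x, y))%E.
  rewrite [LHS]integralE; congr (_ - _)%E; apply: eq_integral => y _.
    exact: (congr1 (@^~ y) (funepos_comp (EFin \o F) (pair x))).
  exact: (congr1 (@^~ y) (funeneg_comp (EFin \o F) (pair x))).
rewrite /Rintegral; under eq_fun do rewrite E.
apply: (measurableT_comp (fine_measurable measurableT)) => //.
apply: emeasurable_funB; apply: measurable_fun_fubini_tonelli_F => //.
- exact: measurable_funepos.
- exact: measurable_funeneg.
Qed.

(** The real-valued inner integral takes a junk value where it diverges; this only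
    happens on a null set, which the outer integral does not see. *)
Lemma ae_Rintegral F : (m1 \x m2)%E.-integrable setT (EFin \o F) ->
  ae_eq m1 setT (fun x => (\int[m2]_y F (x, y))%:E)
                (fun x => \int[m2]_y (F (x, y))%:E)%E.
Proof.
move=> iF; have := ae_integrable1 iF; apply: filterS => x /= ix _.
by rewrite /Rintegral fineK//; exact: integrable_fin_num ix.
Qed.

Lemma integrable_Rintegral F : (m1 \x m2)%E.-integrable setT (EFin \o F) ->
  m1.-integrable setT (fun x => (\int[m2]_y F (x, y))%:E).
Proof.
move=> iF; have mF : measurable_fun setT F.
  by case/integrableP : iF => /measurable_EFinP.
have mI : measurable_fun setT (fun x => (\int[m2]_y F (x, y))%:E).
  by apply/measurable_EFinP; exact: measurable_Rintegral.
apply/integrableP; split => //.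
have /integrableP[mJ] := integrable_fubini_F iF.
apply: le_lt_trans; rewrite le_eqVlt; apply/orP; left; apply/eqP.
apply: ae_eq_integral => //.
- exact: measurableT_comp.
- exact: measurableT_comp.
- by have := ae_Rintegral iF; apply: filterS => x /(_ I) E _; exact: (congr1 abse E).
Qed.

Lemma Rintegral_prod F : (m1 \x m2)%E.-integrable setT (EFin \o F) ->
  \int[(m1 \x m2)%E]_z F z = \int[m1]_x \int[m2]_y F (x, y).
Proof.
move=> iF; have mF : measurable_fun setT F.
  by case/integrableP : iF => /measurable_EFinP.
rewrite {1}/Rintegral -integral12_prod_meas1//; congr fine.
apply: ae_eq_integral => //.
- exact: measurable_int (integrable_fubini_F iF).
- by apply/measurable_EFinP; exact: measurable_Rintegral.
- apply: ae_eq_sym; exact: ae_Rintegral.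
Qed.

End RealFubini.

Section RealFubiniSwap.
Context d1 d2 (T1 : measurableType d1) (T2 : measurableType d2) (R : realType).
Variable m1 : {sigma_finite_measure set T1 -> \bar R}.
Variable m2 : {sigma_finite_measure set T2 -> \bar R}.
Implicit Type F : T1 * T2 -> R.

Lemma measurable_swap_prod F : measurable_fun setT F ->
  measurable_fun setT (fun z : T2 * T1 => F (z.2, z.1)).
Proof.
move=> mF; apply: (measurableT_comp mF).
exact: measurable_fun_pair.
Qed.

Lemma integrable_swap_prod F : (m1 \x m2)%E.-integrable setT (EFin \o F) ->
  (m2 \x m1)%E.-integrable setT (fun z : T2 * T1 => (F (z.2, z.1))%:E).
Proof.
move=> iF; have mF : measurable_fun setT F.
  by case/integrableP : iF => /measurable_EFinP.
have mE : measurable_fun setT (EFin \o F) by exact/measurable_EFinP.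
have mE' : measurable_fun setT (fun z : T2 * T1 => (F (z.2, z.1))%:E).
  by apply/measurable_EFinP; exact: measurable_swap_prod.
apply/(integrable21ltyP _ _ mE') => /=.
by move/(integrable12ltyP _ _ mE) : iF.
Qed.

Lemma Rintegral_Fubini F : (m1 \x m2)%E.-integrable setT (EFin \o F) ->
  \int[m1]_x \int[m2]_y F (x, y) = \int[m2]_y \int[m1]_x F (x, y).
Proof.
move=> iF; rewrite -Rintegral_prod//.
rewrite -(Rintegral_prod (F := fun z : T2 * T1 => F (z.2, z.1))); last first.
  exact: integrable_swap_prod.
rewrite /Rintegral; congr fine.
rewrite -integral12_prod_meas1// -integral21_prod_meas1//.
exact: integrable_swap_prod.
Qed.

End RealFubiniSwap.

(** * Affine changes of variables *)

Section Affine.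
Context {R : realType}.
Local Notation lam := (@lebesgue_measure R).
Local Notation mR := (measurableTypeR R).

Definition affine_map (a c : R) : mR -> mR := fun s => a + c * s.

Lemma measurable_affine (a c : R) : measurable_fun setT (affine_map a c).
Proof. by apply: measurable_funD => //; exact: measurable_funM. Qed.

Lemma lebesgue_measure_affine_gt0 (a c : R) (A : set mR) : 0 < c -> measurable A ->
  (pushforward lam (affine_map a c) A = (c^-1)%:E * lam A)%E.
Proof.
move=> c0 mA.
have ci : 0 <= c^-1 by rewrite invr_ge0 ltW.
pose m : {measure set mR -> \bar R} := mscale (NngNum (ltW c0))
  (measure_function_pushforward__canonical__measure_function_Measure lam
    (measurable_affine a c)).
have mE B : m B = (c%:E * lam (affine_map a c @^-1` B))%E by [].
(* Half-open intervals scale as they should, and they determine Lebesgue measure. *)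
have E : lam A = m A.
  apply: lebesgue_measure_unique => // _ [[x y]] _ <-.
  rewrite mE (_ : _ @^-1` _ = `] ((x - a) / c), ((y - a) / c) ]%classic).
    rewrite !lebesgue_measure_itv/= !lte_fin ltr_pM2r ?invr_gt0// ltrD2r.
    by case: ifPn => _; rewrite ?mule0// -EFinM; congr EFin; field; rewrite gt_eqF.
  apply/seteqP; split => s /=; rewrite !in_itv/= ltr_pdivrMr// ler_pdivlMr//;
    by rewrite ltrBlDl lerBrDl (mulrC s).
rewrite E mE muleA -EFinM mulVf ?gt_eqF// mul1e//.
Qed.

(** A negative slope is a positive one composed with a reflection, which preserves
    Lebesgue measure. *)
Lemma lebesgue_measure_affine (a c : R) (A : set mR) : c != 0 -> measurable A ->
  (pushforward lam (affine_map a c) A = (`|c|^-1)%:E * lam A)%E.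
Proof.
move=> c0 mA; have [cn|cp|ce] := ltgtP c 0; last by rewrite ce eqxx in c0.
- rewrite ltr0_norm// -(@lebesgue_measure_affine_gt0 a) ?oppr_gt0//.
  have mB : measurable (affine_map a (- c) @^-1` A).
    by rewrite -[X in measurable X]setTI; exact: measurable_affine.
  rewrite /pushforward -(lebesgue_measureN mB) /pushforward; congr (lam _).
  by apply/seteqP; split => s /=; rewrite /affine_map mulrNN.
- by rewrite gtr0_norm// lebesgue_measure_affine_gt0.
Qed.

Lemma ge0_integral_affine (a c : R) (v : mR -> \bar R) : c != 0 ->
  measurable_fun setT v -> (forall x, 0 <= v x)%E ->
  (\int[lam]_s v (a + c * s)%R = (`|c|^-1)%:E * \int[lam]_s v s)%E.
Proof.
move=> c0 mv v0; have ci : 0 <= `|c|^-1 by rewrite invr_ge0.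
rewrite -(ge0_integral_mscale lam measurableT (NngNum ci))//.
transitivity (\int[pushforward lam (affine_map a c)]_s v s)%E.
  by rewrite ge0_integral_pushforward//; exact: measurable_affine.
apply: eq_measure_integral => [|mf A mA _]; first exact: measurable_affine.
exact: lebesgue_measure_affine.
Qed.

Lemma integrable_affine (a c : R) (v : R -> R) : c != 0 ->
  lam.-integrable setT (EFin \o v) ->
  lam.-integrable setT (fun s => (v (a + c * s))%:E).
Proof.
move=> c0 /integrableP[mv iv]; apply/integrableP; split.
  exact: (measurableT_comp mv (measurable_affine a c)).
rewrite (ge0_integral_affine a (v := fun s => `|(v s)%:E|%E))//.
  by rewrite lte_mul_pinfty// lee_fin.
exact: measurableT_comp.
Qed.

Lemma Rintegral_affine (a c : R) (v : R -> R) : c != 0 ->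
  lam.-integrable setT (EFin \o v) ->
  \int[lam]_s v (a + c * s) = `|c|^-1 * \int[lam]_s v s.
Proof.
move=> c0 iv; have /integrableP[mv _] := iv.
have ci : (`|c|^-1)%:E \is a fin_num by [].
rewrite /Rintegral -[X in X * _]/(fine (`|c|^-1)%:E) -fineM//; last first.
  exact: integrable_fin_num.
congr fine; rewrite integralE [in RHS]integralE muleBr//; last first.
  by rewrite fin_num_adde_defr//; apply: integrable_fin_num => //; exact: integrable_funepos.
rewrite -!(ge0_integral_affine a)//; last 2 first.
- by apply: measurable_funeneg; exact: mv.
- by apply: measurable_funepos; exact: mv.
congr (_ - _)%E; apply: eq_integral => x _.
- exact: (congr1 (@^~ x) (funepos_comp (EFin \o v) (affine_map a c))).
- exact: (congr1 (@^~ x) (funeneg_comp (EFin \o v) (affine_map a c))).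
Qed.

End Affine.

Lemma ae_impl d (T : measurableType d) (R : realType)
  (m : {measure set T -> \bar R}) (Q1 Q2 : T -> Prop) :
  (forall x, Q1 x -> Q2 x) -> {ae m, forall x, Q1 x} -> {ae m, forall x, Q2 x}.
Proof. by move=> h; apply: filterS. Qed.

(** * Integrable and square-integrable functions on the line *)

Section L2.
Context {R : realType}.
Local Notation lam := (@lebesgue_measure R).
Local Notation mR := (measurableTypeR R).

Definition L1 (k : R -> R) := lam.-integrable setT (EFin \o k).

Variant L2 (u : R -> R) : Prop :=
  L2_intro of measurable_fun setT (u : mR -> R) &
    lam.-integrable setT (fun x => (u x ^+ 2)%:E).

Lemma L1_measurable k : L1 k -> measurable_fun setT (k : mR -> R).
Proof. by case/integrableP => /measurable_EFinP. Qed.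

Lemma L1_norm k : L1 k -> L1 (fun x => `|k x|).
Proof. exact: integrable_norm. Qed.

Lemma integrable_le d (T : measurableType d) (m : {measure set T -> \bar R})
  (v w : T -> R) : measurable_fun setT v -> m.-integrable setT (fun x => (w x)%:E) ->
  (forall x, `|v x| <= w x) -> m.-integrable setT (fun x => (v x)%:E).
Proof.
move=> mv iw vw; apply: (le_integrable measurableT _ _ iw).
  exact/measurable_EFinP.
by move=> x _ /=; rewrite lee_fin (le_trans (vw x)) // ler_norm.
Qed.

Lemma L2_mul u v : L2 u -> L2 v -> lam.-integrable setT (fun x => (u x * v x)%:E).
Proof.
move=> [mu iu] [mv iv].
apply: (integrable_le (w := fun x : mR => u x ^+ 2 + v x ^+ 2)).
- exact: measurable_funM.
- by under eq_fun do rewrite EFinD; exact: integrableD.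
- move=> x; rewrite ler_norml; apply/andP; split; nra.
Qed.

Lemma L2D u v : L2 u -> L2 v -> L2 (fun x => u x + v x).
Proof.
move=> [mu iu] [mv iv]; split; first exact: measurable_funD.
apply: (integrable_le (w := fun x : mR => 2 * (u x ^+ 2 + v x ^+ 2))).
- by apply: measurable_funX; exact: measurable_funD.
- under eq_fun do rewrite EFinM.
  apply: integrableZl => //.
  by under eq_fun do rewrite EFinD; exact: integrableD.
- move=> x; rewrite ger0_norm ?sqr_ge0//.
  have := sqr_ge0 (u x - v x); nra.
Qed.

Lemma L2Z a u : L2 u -> L2 (fun x => a * u x).
Proof.
move=> [mu iu]; split; first exact: measurable_funM.
by under eq_fun do rewrite exprMn EFinM; exact: integrableZl.
Qed.

Lemma L2B u v : L2 u -> L2 v -> L2 (fun x => u x - v x).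
Proof.
move=> l2u l2v; have := L2D l2u (L2Z (-1) l2v).
by under eq_fun do rewrite mulN1r.
Qed.

Lemma L2_affine a c u : c != 0 -> L2 u -> L2 (fun s => u (a + c * s)).
Proof.
move=> c0 [mu iu]; split.
  exact: (measurableT_comp mu (measurable_affine a c)).
exact: (integrable_affine a c0 iu).
Qed.

Lemma L2_shift h u : L2 u -> L2 (fun s => u (s + h)).
Proof.
move=> /(L2_affine h (oner_neq0 R)).
by under eq_fun do rewrite mul1r addrC.
Qed.

Lemma integrable_shift h (v : R -> R) :
  lam.-integrable setT (EFin \o v) -> lam.-integrable setT (fun s => (v (s + h))%:E).
Proof.
move=> /(integrable_affine h (oner_neq0 R)).
by under eq_fun do rewrite mul1r addrC.
Qed.

Lemma Rintegral_shift h (v : R -> R) :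
  lam.-integrable setT (EFin \o v) -> \int[lam]_s v (s + h) = \int[lam]_s v s.
Proof.
move=> /(Rintegral_affine h (oner_neq0 R)); rewrite normr1 invr1 mul1r => <-.
by apply: eq_Rintegral => s _; rewrite mul1r addrC.
Qed.

Lemma ge0_integral_shift h (v : mR -> \bar R) :
  measurable_fun setT v -> (forall x, 0 <= v x)%E ->
  (\int[lam]_s v (s + h)%R = \int[lam]_s v s)%E.
Proof.
move=> mv v0; have := ge0_integral_affine h (oner_neq0 R) mv v0.
rewrite normr1 invr1 mul1e => <-.
by apply: eq_integral => s _; rewrite mul1r addrC.
Qed.

End L2.

(** * A weighted Cauchy-Schwarz inequality *)

Section WeightedCauchySchwarz.
Context d (T : measurableType d) (R : realType) (m : {measure set T -> \bar R}).

(** The case a = 0 is included, so that the weight below may vanish almost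
    everywhere. *)
Lemma discriminant_le (a b c : R) : 0 <= a ->
  (forall x, 0 <= c - 2 * x * b + x ^+ 2 * a) -> b ^+ 2 <= a * c.
Proof.
move=> a0 h; have [a1|] := eqVneq a 0.
  rewrite a1 mul0r; have [->|b0] := eqVneq b 0; first by rewrite expr0n.
  have := h ((c + 1) / (2 * b)); rewrite a1 mulr0 addr0.
  have -> : 2 * ((c + 1) / (2 * b)) * b = c + 1 by field.
  lra.
move=> an0; have ap : 0 < a by rewrite lt_neqAle eq_sym an0.
have := h (b / a).
have -> : c - 2 * (b / a) * b + (b / a) ^+ 2 * a = (a * c - b ^+ 2) / a by field.
by rewrite pmulr_lge0 ?invr_gt0// subr_ge0.
Qed.

Lemma integrable_mul_sqr_weight (k v : T -> R) :
  measurable_fun setT v ->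
  m.-integrable setT (EFin \o k) ->
  m.-integrable setT (fun t => (`|k t| * v t ^+ 2)%:E) ->
  m.-integrable setT (fun t => (k t * v t)%:E).
Proof.
move=> mv ik ikv; have mk : measurable_fun setT k.
  by case/integrableP : ik => /measurable_EFinP.
apply: (integrable_le (w := fun t => `|k t| + `|k t| * v t ^+ 2)).
- exact: measurable_funM.
- under eq_fun do rewrite EFinD; apply: integrableD => //.
  exact: integrable_norm ik.
- move=> t; rewrite normrM -[X in X + _]mulr1 -mulrDr ler_wpM2l//.
  by rewrite ler_norml; apply/andP; split; nra.
Qed.

(** The integral of |k| (|v| - x)^2 is nonnegative for every real x, and its
    discriminant as a quadratic in x gives the bound. *)
Lemma weighted_cauchy_schwarz (k v : T -> R) :
  measurable_fun setT v ->
  m.-integrable setT (EFin \o k) ->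
  m.-integrable setT (fun t => (`|k t| * v t ^+ 2)%:E) ->
  (\int[m]_t (k t * v t)) ^+ 2 <=
  (\int[m]_t `|k t|) * (\int[m]_t (`|k t| * v t ^+ 2)).
Proof.
move=> mv ik ikv.
have ink : m.-integrable setT (fun t => `|k t|%:E) by exact: integrable_norm ik.
have iv := integrable_mul_sqr_weight mv ik ikv.
have inv : m.-integrable setT (fun t => (`|k t| * `|v t|)%:E).
  have := integrable_norm iv; rewrite /comp.
  by under eq_fun do rewrite normrM.
apply: (@le_trans _ _ ((\int[m]_t (`|k t| * `|v t|)) ^+ 2)).
  rewrite -[leLHS]real_normK ?num_real// lerXn2r ?nnegrE ?normr_ge0//.
    by apply: Rintegral_ge0 => *; rewrite mulr_ge0.
  rewrite (le_trans (le_normr_Rintegral _ iv))//.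
  by rewrite le_eqVlt; apply/orP; left; apply/eqP/eq_Rintegral => t _; rewrite normrM.
apply: discriminant_le => [|x]; first exact: Rintegral_ge0.
have i1 : m.-integrable setT (fun t => (2 * x * (`|k t| * `|v t|))%:E).
  by under eq_fun do rewrite EFinM; exact: integrableZl.
have i2 : m.-integrable setT (fun t => (x ^+ 2 * `|k t|)%:E).
  by under eq_fun do rewrite EFinM; exact: integrableZl.
have i3 : m.-integrable setT (fun t => (`|k t| * v t ^+ 2 - 2 * x * (`|k t| * `|v t|))%:E).
  by under eq_fun do rewrite EFinB; exact: integrableB.
rewrite -[X in X + _](_ : \int[m]_t (`|k t| * v t ^+ 2 - 2 * x * (`|k t| * `|v t|)) = _); last first.
  by rewrite RintegralB// RintegralZl.
rewrite [x ^+ 2 * _]mulrC -RintegralZr//.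
have i2' : m.-integrable setT (fun t => (`|k t| * x ^+ 2)%:E).
  by under eq_fun do rewrite mulrC.
rewrite -RintegralD//; apply: Rintegral_ge0 => t _.
have -> : `|k t| * v t ^+ 2 - 2 * x * (`|k t| * `|v t|) + `|k t| * x ^+ 2 =
  `|k t| * (`|v t| - x) ^+ 2.
  by rewrite -[v t ^+ 2]real_normK ?num_real//; ring.
by rewrite mulr_ge0// sqr_ge0.
Qed.

End WeightedCauchySchwarz.

(** * Smoothing by correlation *)

Section Corr.
Context {R : realType}.
Local Notation lam := (@lebesgue_measure R).
Local Notation mR := (measurableTypeR R).
Implicit Types k u phi : R -> R.

(** Up to the sign of the scale this is convolution with the dilation of k. The sign
    is chosen so that autocorrelations are of this form, and taking the scale as a
    factor inside u makes c = 0 legitimate. *)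
Definition corr (c : R) k u (s : R) : R := \int[lam]_t (k t * u (s + c * t)).

Lemma measurable_shear c : measurable_fun setT (fun z : mR * mR => z.1 + c * z.2 : mR).
Proof.
apply: measurable_funD => //.
by apply: measurable_funM => //; exact: measurable_snd.
Qed.

Lemma measurable_corr_kernel c k u : measurable_fun setT (k : mR -> R) ->
  measurable_fun setT (u : mR -> R) ->
  measurable_fun setT (fun z : mR * mR => k z.2 * u (z.1 + c * z.2)).
Proof.
move=> mk mu; apply: measurable_funM.
  exact: (measurableT_comp mk measurable_snd).
exact: (measurableT_comp mu (measurable_shear c)).
Qed.

Lemma measurable_corr c k u : measurable_fun setT (k : mR -> R) ->
  measurable_fun setT (u : mR -> R) -> measurable_fun setT (corr c k u : mR -> R).
Proof.
move=> mk mu.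
exact: (measurable_Rintegral lam (measurable_corr_kernel c mk mu)).
Qed.

(** The integral in s, taken first, is translation invariant and so is the same for
    every t. *)
Lemma integrable_sheared c (w : R -> R) (k : R -> R) :
  L1 k -> lam.-integrable setT (EFin \o w) ->
  (lam \x lam)%E.-integrable setT (fun z : mR * mR => (k z.2 * w (z.1 + c * z.2))%:E).
Proof.
move=> l1k iw; have mw : measurable_fun setT (w : mR -> R).
  by case/integrableP : iw => /measurable_EFinP.
have mk := L1_measurable l1k.
have mF : measurable_fun setT (fun z : mR * mR => (k z.2 * w (z.1 + c * z.2))%:E).
  by apply/measurable_EFinP; exact: measurable_corr_kernel.
apply/(integrable21ltyP _ _ mF) => /=.
under eq_integral => t _.
  under eq_integral do rewrite normrM EFinM.
  rewrite ge0_integralZl//; last first.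
    do 2 apply/measurableT_comp => //.
    by apply: (measurableT_comp mw); exact: measurable_funD.
  rewrite (ge0_integral_shift (c * t) (v := fun s => `|w s|%:E))//; last first.
    by apply/measurable_EFinP; exact: measurableT_comp.
  over.
rewrite ge0_integralZr//; last 2 first.
- by apply/measurable_EFinP; exact: measurableT_comp.
- exact: integral_ge0.
case/integrableP : l1k => _ ik; case/integrableP : iw => _ iw.
by rewrite lte_mul_pinfty// ?integral_ge0// ge0_fin_numE// integral_ge0.
Qed.

Lemma ae_corr_weight c k u : L1 k -> L2 u ->
  {ae lam, forall s, lam.-integrable setT (fun t => (`|k t| * u (s + c * t) ^+ 2)%:E)}.
Proof.
move=> l1k [mu iu].
exact: (ae_integrable1 (integrable_sheared c (L1_norm l1k) iu)).
Qed.

Lemma measurable_shear1 c u (s : R) : measurable_fun setT (u : mR -> R) ->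
  measurable_fun setT (fun t : mR => u (s + c * t)).
Proof. by move=> mu; exact: (measurableT_comp mu (measurable_affine s c)). Qed.

Lemma ae_corr_integrable c k u : L1 k -> L2 u ->
  {ae lam, forall s, lam.-integrable setT (fun t => (k t * u (s + c * t))%:E)}.
Proof.
move=> l1k l2u; have := ae_corr_weight c l1k l2u; apply: ae_impl => s.
by apply: integrable_mul_sqr_weight => //; apply: measurable_shear1; case: l2u.
Qed.

(** Young's inequality for the exponents 1 and 2: Cauchy-Schwarz against the weight
    |k| bounds the square of the inner integral, and the integral in s of the bound
    factors by translation invariance. *)
Lemma corr_young c k u : L1 k -> L2 u ->
  L2 (corr c k u) /\
  roughness (corr c k u) <= (\int[lam]_t `|k t|) ^+ 2 * roughness u.
Proof.
move=> l1k l2u; have [mu iu] := l2u; have mk := L1_measurable l1k.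
set a := \int[lam]_t `|k t|.
have a0 : 0 <= a by exact: Rintegral_ge0.
have iF := integrable_sheared c (L1_norm l1k) iu.
pose D s := \int[lam]_t (`|k t| * u (s + c * t) ^+ 2).
have D0 s : 0 <= D s by apply: Rintegral_ge0 => *; rewrite mulr_ge0 ?sqr_ge0.
have iD : lam.-integrable setT (EFin \o D) by exact: (integrable_Rintegral iF).
have mc := measurable_corr c mk mu.
have mD : measurable_fun setT (D : mR -> R) by case/integrableP : iD => /measurable_EFinP.
have le : (\int[lam]_s (corr c k u s ^+ 2)%:E <= \int[lam]_s (a * D s)%:E)%E.
  apply: ae_ge0_le_integral => //.
  - by move=> s _; rewrite lee_fin sqr_ge0.
  - by apply/measurable_EFinP; exact: measurable_funX.
  - by move=> s _; rewrite lee_fin mulr_ge0.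
  - by apply/measurable_EFinP; exact: measurable_funM.
  have := ae_corr_weight c l1k l2u; apply: ae_impl => s is_ _.
  by rewrite lee_fin; apply: weighted_cauchy_schwarz => //; exact: measurable_shear1.
have iaD : lam.-integrable setT (fun s => (a * D s)%:E).
  by under eq_fun do rewrite EFinM; exact: integrableZl.
have ED : \int[lam]_s D s = a * roughness u.
  rewrite /D (Rintegral_Fubini iF)/=.
  under eq_Rintegral => t _.
    rewrite RintegralZl//; last exact: (integrable_shift _ iu).
    rewrite (Rintegral_shift (c * t) iu); over.
  by rewrite RintegralZr//; exact: L1_norm.
have i2 : lam.-integrable setT (fun s => (corr c k u s ^+ 2)%:E).
  apply/integrableP; split; first by apply/measurable_EFinP; exact: measurable_funX.
  under eq_integral do rewrite gee0_abs ?lee_fin ?sqr_ge0//.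
  by apply: le_lt_trans le _; exact: integrable_lty.
split; first by split.
rewrite expr2 -mulrA -ED -RintegralZl//.
by rewrite /roughness /Rintegral fine_le//; exact: integrable_fin_num.
Qed.

(** Fubini's theorem applies because k(t) phi(s) u(s + c t) is dominated by
    |k(t)| (u(s + c t)^2 + phi(s)^2). Adjointness and the action of weak derivatives
    on correlations are both read off the right-hand side, where the inner integral
    pairs phi with a translate of u. *)
Lemma corr_swap c k phi u : L1 k -> L2 phi -> L2 u ->
  \int[lam]_s (phi s * corr c k u s) =
  \int[lam]_t (k t * \int[lam]_s (phi s * u (s + c * t))).
Proof.
move=> l1k l2p l2u.
have [mu iu] := l2u; have [mp ip] := l2p; have mk := L1_measurable l1k.
pose F (z : mR * mR) := phi z.1 * (k z.2 * u (z.1 + c * z.2)).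
have mF : measurable_fun setT F.
  apply: measurable_funM; last exact: measurable_corr_kernel.
  exact: (measurableT_comp mp measurable_fst).
have iF : (lam \x lam)%E.-integrable setT (EFin \o F).
  have i1 := integrable_sheared c (L1_norm l1k) iu.
  have i2 := integrable_sheared 0 (L1_norm l1k) ip.
  apply: (integrable_le mF (integrableD measurableT i1 i2)) => z /=.
  rewrite mul0r addr0 /F mulrCA normrM -mulrDr ler_wpM2l//.
  by rewrite ler_norml; apply/andP; split; nra.
have := Rintegral_Fubini iF; rewrite /F/=.
move=> E; transitivity (\int[lam]_x \int[lam]_y (phi x * (k y * u (x + c * y)))).
  congr fine; apply: ae_eq_integral => //.
  - by apply/measurable_EFinP; apply: measurable_funM => //; exact: measurable_corr.
  - by apply/measurable_EFinP; exact: (measurable_Rintegral lam mF).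
  have := ae_corr_integrable c l1k l2u; apply: ae_impl => s is_ _.
  by rewrite RintegralZl.
rewrite E; apply: eq_Rintegral => t _.
rewrite -RintegralZl//; last exact: (L2_mul l2p (L2_shift _ l2u)).
by apply: eq_Rintegral => s _; rewrite mulrCA.
Qed.

End Corr.

Lemma ae_impl2 d (T : measurableType d) (R : realType)
  (m : {measure set T -> \bar R}) (Q1 Q2 Q3 : T -> Prop) :
  (forall x, Q1 x -> Q2 x -> Q3 x) -> {ae m, forall x, Q1 x} ->
  {ae m, forall x, Q2 x} -> {ae m, forall x, Q3 x}.
Proof. by move=> h; apply: filterS2. Qed.

Section DominatedConvergence.
Context d (T : measurableType d) (R : realType) (m : {measure set T -> \bar R}).

Lemma Rintegral_dominated_cvg0 (F : nat -> T -> R) (G : T -> R) :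
  (forall n, measurable_fun setT (F n)) ->
  (forall x, F ^~ x @ \oo --> 0) ->
  m.-integrable setT (fun x => (G x)%:E) ->
  (forall n x, `|F n x| <= G x) ->
  (fun n => \int[m]_x F n x) @ \oo --> 0.
Proof.
move=> mF F0 iG FG.
have mE n : measurable_fun setT (fun x => (F n x)%:E) by exact/measurable_EFinP.
have [||_ _] := @dominated_convergence _ _ _ m _ measurableT
    (fun n x => (F n x)%:E) (cst 0%E) (fun x => (G x)%:E) mE (measurable_cst _) _ iG.
- by apply: aeW => x _; apply: cvg_EFin; [exact: nearW|exact: F0].
- by apply: aeW => x n _; rewrite lee_fin.
rewrite integral0 => c0; exact: (fine_cvg c0).
Qed.

End DominatedConvergence.

(** * Continuity of translations in L2 *)

Section Translation.
Context {R : realType}.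
Local Notation lam := (@lebesgue_measure R).
Local Notation mR := (measurableTypeR R).
Implicit Types u v w : R -> R.

Lemma roughness_ge0 u : 0 <= roughness u.
Proof. by apply: Rintegral_ge0 => x _; rewrite sqr_ge0. Qed.

Lemma roughness_shift h u : L2 u -> roughness (fun s => u (s + h)) = roughness u.
Proof. by move=> [_ iu]; exact: (Rintegral_shift h iu). Qed.

Lemma roughnessZ a u : L2 u -> roughness (fun s => a * u s) = a ^+ 2 * roughness u.
Proof.
move=> [_ iu]; rewrite /roughness -RintegralZl//.
by apply: eq_Rintegral => x _; rewrite exprMn.
Qed.

Lemma roughnessD_le u v : L2 u -> L2 v ->
  roughness (fun s => u s + v s) <= 2 * roughness u + 2 * roughness v.
Proof.
move=> l2u l2v; have [_ iu] := l2u; have [_ iv] := l2v.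
have [_ iuv] := L2D l2u l2v.
have iu2 : lam.-integrable setT (fun x => (2 * u x ^+ 2)%:E).
  by under eq_fun do rewrite EFinM; exact: integrableZl.
have iv2 : lam.-integrable setT (fun x => (2 * v x ^+ 2)%:E).
  by under eq_fun do rewrite EFinM; exact: integrableZl.
rewrite /roughness -!RintegralZl// -RintegralD//.
apply: le_Rintegral => //.
  by rewrite /comp; under eq_fun do rewrite EFinD; exact: integrableD.
move=> x _; have := sqr_ge0 (u x - v x); nra.
Qed.

Lemma roughnessB_le u v : L2 u -> L2 v ->
  roughness (fun s => u s - v s) <= 2 * roughness u + 2 * roughness v.
Proof.
move=> l2u l2v; have := roughnessD_le l2u (L2Z (-1) l2v).
rewrite roughnessZ// sqrrN expr1n mul1r.
have -> // : (fun s => u s - v s) = (fun s => u s + -1 * v s).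
by apply/funext => s; rewrite mulN1r.
Qed.

(** Continuity of translations at 0 in L2. Sequences suffice, and they are what
    dominated convergence handles. *)
Definition shift_continuous u := forall h : nat -> R, h @ \oo --> 0 ->
  (fun n => roughness (fun s => u (s + h n) - u s)) @ \oo --> 0.

(** The error of u is at most that of w plus twice the distance of u to w,
    translations being isometries. *)
Lemma shift_continuous_closed u : L2 u ->
  (forall e, 0 < e -> exists w, [/\ L2 w, shift_continuous w &
    roughness (fun s => u s - w s) <= e]) -> shift_continuous u.
Proof.
move=> l2u H h h0; apply/cvgrPdist_lt => e e0.
(* Each use of (x + y)^2 <= 2 x^2 + 2 y^2 costs a factor 2: the distance of u to w
   enters with weight 2 * (2 + 2) = 8, the error of w with weight 2. *)
have e16 : 0 < e / 16 by rewrite divr_gt0.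
have [w [l2w cw uw]] := H _ e16.
have e4 : 0 < e / 4 by rewrite divr_gt0.
have /cvgrPdist_lt /(_ _ e4) := cw h h0; apply: filterS => n.
rewrite !sub0r !normrN !ger0_norm ?roughness_ge0// => wn.
pose v s := u s - w s.
have l2v : L2 v by exact: L2B.
have -> : (fun s => u (s + h n) - u s) =
    (fun s => (v (s + h n) - v s) + (w (s + h n) - w s)).
  by apply/funext => s; rewrite /v; ring.
apply: (le_lt_trans (roughnessD_le (L2B (L2_shift _ l2v) l2v) (L2B (L2_shift _ l2w) l2w))).
have := roughnessB_le (L2_shift (h n) l2v) l2v.
rewrite roughness_shift//; rewrite -/(roughness _) in uw.
have : roughness v <= e / 16 by [].
move: wn; lra.
Qed.

Lemma integrable_bounded_support (B M : R) (v : R -> R) :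
  measurable_fun setT (v : mR -> R) -> (forall s, `|v s| <= M) ->
  (forall s, B < `|s| -> v s = 0) -> lam.-integrable setT (EFin \o v).
Proof.
move=> mv vM vB.
have mI : measurable (`[- B, B] : set mR) by exact: measurable_itv.
apply: (integrable_le (w := fun s : mR => M * \1_(`[- B, B]%classic) s)) => //.
  under eq_fun do rewrite EFinM; apply: integrableZl => //.
  exact: (integrable_indic_itv (- B) B true false).
move=> s; rewrite indicE; have [|] := boolP (s \in `[- B, B]%classic).
  by rewrite mulr1.
move/negP => sB; rewrite mulr0 vB ?normr0//.
rewrite ltNge; apply/negP => /ler_normlP[s1 s2]; apply: sB.
by rewrite inE/= in_itv/= s2 lerNl s1.
Qed.

(** Pointwise convergence comes from continuity; the domination uses that the
    translates by a convergent, hence bounded, sequence share a bounded support. *)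
Lemma shift_continuous_Cc (B M : R) w : continuous w -> (forall s, `|w s| <= M) ->
  (forall s, B < `|s| -> w s = 0) -> L2 w /\ shift_continuous w.
Proof.
move=> cw wM wB.
have mw : measurable_fun setT (w : mR -> R) by exact: continuous_measurable_fun.
have M0 : 0 <= M by exact: le_trans (wM 0).
have l2w : L2 w.
  split=> //; apply: (@integrable_bounded_support B (M ^+ 2)).
  - exact: measurable_funX.
  - by move=> s; rewrite normrX lerXn2r ?nnegrE.
  - by move=> s /wB ->; rewrite expr0n.
split=> // h h0.
have [H hH] : exists H, forall n, `|h n| <= H.
  have /cvg_seq_bounded/pinfty_ex_gt0 [H _ HH] : cvgn h by apply/cvg_ex; exists 0.
  by exists H => n; exact: HH.
pose G (s : mR) : R := 4 * M ^+ 2 * \1_(`[- (B + H), B + H]%classic) s.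
apply: (Rintegral_dominated_cvg0 (G := G)).
- move=> n; apply: measurable_funX; apply: measurable_funB => //.
  by case: (L2_shift (h n) l2w).
- move=> s; rewrite -[X in _ --> X](expr0n _ 2) -[X in X ^+ 2](subrr (w s)).
  rewrite expr2; under eq_fun do rewrite expr2.
  have c1 : (fun n => w (s + h n) - w s) @ \oo --> w s - w s.
    apply: cvgB; last exact: cvg_cst.
    have hs : (fun n => s + h n) @ \oo --> s.
      by rewrite -[X in _ --> X]addr0; apply: cvgD => //; exact: cvg_cst.
    exact: (cvg_comp _ _ hs (cw s)).
  exact: cvgM.
- rewrite /G; under eq_fun do rewrite EFinM; apply: integrableZl => //.
  exact: (integrable_indic_itv (- (B + H)) (B + H) true false).
- move=> n s; rewrite ger0_norm ?sqr_ge0// /G indicE.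
  have [_|] := boolP (s \in _).
    have := wM s; have := wM (s + h n); rewrite mulr1 !ler_norml => /andP[? ?] /andP[? ?]; nra.
  move/negP => sB.
  have Hs : B + H < `|s|.
    rewrite ltNge; apply/negP => /ler_normlP[s1 s2]; apply: sB.
    by rewrite inE/= in_itv/= s2 lerNl s1.
  have H0 : 0 <= H by exact: le_trans (hH 0).
  rewrite (wB s) ?(wB (s + h n)) ?subr0 ?expr0n/= ?mulr0//; last lra.
  have := ler_normD (s + h n) (- h n); rewrite addrK normrN.
  have := hH n; lra.
Qed.

(** An L1 approximation of v by continuous functions becomes an L2 approximation
    after clipping it at the bound of v, since then (v - w)^2 <= 2 M |v - w|. A
    trapezoidal cutoff makes it compactly supported; neither operation increases the
    distance to v. *)
Lemma shift_continuous_bounded (A M : R) v : 0 <= A -> measurable_fun setT (v : mR -> R) ->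
  (forall s, `|v s| <= M) -> (forall s, A < `|s| -> v s = 0) ->
  L2 v /\ shift_continuous v.
Proof.
move=> A0 mv vM vA.
have M0 : 0 <= M by exact: le_trans (vM 0).
have l2v : L2 v.
  split=> //; apply: (@integrable_bounded_support A (M ^+ 2)).
  - exact: measurable_funX.
  - by move=> s; rewrite normrX lerXn2r ?nnegrE.
  - by move=> s /vA ->; rewrite expr0n.
split=> //; apply: shift_continuous_closed => // e e0.
pose E : set mR := `[- (A + 1), A + 1]%classic.
have mE : measurable E by exact: measurable_itv.
have finE : (lam E < +oo)%E.
  by rewrite lebesgue_measure_itv/=; case: ifP; rewrite -?EFinB ltry.
have ivE : lam.-integrable E (EFin \o v).
  exact: (integrableS measurableT mE (subsetT _) (integrable_bounded_support mv vM vA)).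
have [g_ [cg ig g0]] := approximation_continuous_integrable mE finE ivE.
pose e' := e / (2 * M + 1).
have e'0 : 0 < e' by rewrite divr_gt0// ltr_wpDl// mulr_ge0.
have [n gn] : exists n, (\int[lam]_(z in E) `|(v z - g_ n z)%:E| < e'%:E)%E.
  have /fine_cvgP[fg /cvgrPdist_lt /(_ _ e'0) g0'] := g0.
  have [n _ /(_ n (leqnn n)) [fn +]] := filterI fg g0'.
  rewrite sub0r normrN ger0_norm ?fine_ge0 ?integral_ge0// => gn.
  by exists n; rewrite -(fineK fn) lte_fin.
pose g := g_ n.
pose chi (s : R) : R := Num.max 0 (Num.min 1 (A + 1 - `|s|)).
pose w (s : R) : R := chi s * Num.max (- M) (Num.min M (g s)).
have chi01 s : 0 <= chi s <= 1.
  by rewrite /chi le_max lexx ge_max ler01/= ge_min lexx.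
have clipM s : `|Num.max (- M) (Num.min M (g s))| <= M.
  by rewrite ler_norml le_max lexx/= ge_max ge_min lexx andbT; lra.
have cw : continuous w.
  have cn : continuous (fun s : R => `|s|) by exact: norm_continuous.
  move=> s; apply: continuousM.
    apply: (@continuous_max _ _ (cst 0)); first exact: cvg_cst.
    apply: (@continuous_min _ _ (cst 1)); first exact: cvg_cst.
    by apply: continuousB; [exact: cvg_cst|exact: cn].
  apply: (@continuous_max _ _ (cst (- M))); first exact: cvg_cst.
  by apply: (@continuous_min _ _ (cst M)); [exact: cvg_cst|exact: cg].
have chiA s : A + 1 < `|s| -> chi s = 0.
  by move=> sA; apply/max_idPl; rewrite ge_min; apply/orP; right; lra.
have wM s : `|w s| <= M.
  have /andP[c0 c1] := chi01 s.
  rewrite normrM (ger0_norm c0) (le_trans (ler_wpM2l c0 (clipM s)))//.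
  by rewrite ler_piMl.
have wA s : A + 1 < `|s| -> w s = 0 by move=> /chiA; rewrite /w => ->; rewrite mul0r.
have [l2w scw] := shift_continuous_Cc cw wM wA.
exists w; split => //.
have clip_near s y : `|y| <= M -> `|y - Num.max (- M) (Num.min M (g s))| <= `|y - g s|.
  rewrite !ler_norml => /andP[y1 y2].
  case: (ltP M (g s)) => [gM|gM]; last case: (ltP (- M) (g s)) => gM'.
  - rewrite (max_idPr _); last lra.
    by rewrite -ler_norml !ler0_norm; lra.
  - by rewrite -ler_norml.
  - by rewrite -ler_norml !ger0_norm; lra.
have pw s : (v s - w s) ^+ 2 <= 2 * M * (`|v s - g s| * \1_E s).
  rewrite indicE; have [|] := boolP (s \in E); last first.
    move=> /negP sE; have sA : A + 1 < `|s|.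
      rewrite ltNge; apply/negP => /ler_normlP[s1 s2]; apply: sE.
      by rewrite inE /E /= in_itv/= s2 lerNl s1.
    by rewrite wA// vA ?(lt_trans _ sA) ?ltrDl// subrr expr0n/= !mulr0.
  move=> _; rewrite mulr1.
  have vw : `|v s - w s| <= `|v s - g s|.
    have [sA|sA] := leP `|s| A.
      have -> : w s = Num.max (- M) (Num.min M (g s)).
        rewrite /w /chi (min_idPl _); last lra.
        by rewrite (max_idPr _) ?mul1r.
      exact: clip_near.
    rewrite (vA _ sA) !sub0r !normrN.
    have /andP[c0 c1] := chi01 s.
    have := clip_near s 0; rewrite normr0 => /(_ M0); rewrite !sub0r !normrN => h.
    by rewrite normrM (ger0_norm c0) (le_trans _ h)// ler_piMl.
  have vwM : `|v s - w s| <= 2 * M.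
    by rewrite (le_trans (ler_normB _ _))//; have := vM s; have := wM s; lra.
  by rewrite -[leLHS]real_normK ?num_real// expr2 ler_pM.
have mg : measurable_fun setT (g : mR -> R) by exact: continuous_measurable_fun (cg n).
have [mvw ivw] : L2 (fun s => v s - w s) by exact: L2B.
have m1 : measurable_fun setT (fun z : mR => `|(v z - g z)%:E|%E).
  apply: measurableT_comp => //; apply/measurable_EFinP; exact: measurable_funB.
have M2 : 0 <= 2 * M by rewrite mulr_ge0.
rewrite -lee_fin /roughness /Rintegral fineK; last exact: integrable_fin_num ivw.
apply: (@le_trans _ _ ((2 * M)%:E * \int[lam]_(z in E) `|(v z - g z)%:E|)%E).
  rewrite [X in (_ <= _ * X)%E]integral_mkcond -ge0_integralZl//; last 2 first.
  - by apply: (measurable_restrictT _ _).1 => //; exact: measurable_funS m1.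
  - by move=> z _; rewrite /patch; case: ifP.
  apply: ge0_le_integral => //.
  - by move=> z _; rewrite lee_fin sqr_ge0.
  - by apply/measurable_EFinP; exact: measurable_funX.
  - apply: measurable_funeM; apply: (measurable_restrictT _ _).1 => //; exact: measurable_funS m1.
  - move=> z _; have := pw z; rewrite indicE /patch; case: ifP => _ /=.
      by rewrite mulr1 -EFinM lee_fin.
    by rewrite !mulr0 mule0 lee_fin.
apply: (@le_trans _ _ ((2 * M)%:E * e'%:E)%E).
  by rewrite lee_wpmul2l ?lee_fin// ltW.
rewrite -EFinM lee_fin /e' mulrA ler_pdivrMr; last lra.
by rewrite mulrC ler_wpM2l ?(ltW e0)//; lra.
Qed.

(** Truncating both the argument and the values reduces to the bounded case. *)
Lemma shift_continuous_L2 u : L2 u -> shift_continuous u.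
Proof.
move=> l2u; have [mu iu] := l2u; apply: shift_continuous_closed => // e e0.
pose v (N : nat) s := if (`|s| <= N%:R) && (`|u s| <= N%:R) then u s else 0.
have mv N : measurable_fun setT (v N : mR -> R).
  apply: measurable_fun_ifT => //.
  apply: measurable_and; apply: measurable_fun_ler => //.
  exact: measurableT_comp.
have vu N s : (u s - v N s) ^+ 2 <= u s ^+ 2.
  by rewrite /v; case: ifP => _; rewrite ?subr0// subrr expr0n sqr_ge0.
have v0 : (fun N => roughness (fun s => u s - v N s)) @ \oo --> 0.
  apply: (Rintegral_dominated_cvg0 (G := fun s : mR => u s ^+ 2)) => //.
  - by move=> N; apply: measurable_funX; exact: measurable_funB.
  - move=> s; apply: cvg_near_cst.
    near=> N; rewrite /v; have -> : `|s| <= N%:R by near: N; exact: nbhs_infty_ger.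
    have -> : `|u s| <= N%:R by near: N; exact: nbhs_infty_ger.
    by rewrite subrr expr0n.
  - by move=> N s; rewrite ger0_norm ?sqr_ge0.
have /cvgrPdist_lt /(_ _ e0) [N _ /(_ N (leqnn N))] := v0.
rewrite sub0r normrN ger0_norm ?roughness_ge0// => vN.
have [||l2v cv] := @shift_continuous_bounded N%:R N%:R (v N) (ler0n _ _) (mv N).
- by move=> s; rewrite /v; case: ifP => [/andP[]//|]; rewrite normr0.
- by move=> s; rewrite /v ltNge => /negbTE ->.
by exists (v N); split => //; exact: ltW.
Unshelve. all: by end_near. Qed.

(** Continuity of the squared norm, from 2 |x y| <= x^2 / a + a y^2 with a small
    weight a on the limit. *)
Lemma roughness_cvg (v : nat -> R -> R) u : (forall n, L2 (v n)) -> L2 u ->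
  (fun n => roughness (fun s => v n s - u s)) @ \oo --> 0 ->
  (fun n => roughness (v n)) @ \oo --> roughness u.
Proof.
move=> l2v l2u vu; apply/cvgrPdist_lt => e e0.
have ru := roughness_ge0 u.
(* The weight y makes y * roughness u at most e / 2. *)
pose y := e / (2 * (roughness u + 1)).
have y0 : 0 < y by rewrite divr_gt0// mulr_gt0// ltr_wpDl.
have y1 : 0 < 1 + y^-1 by rewrite addr_gt0// invr_gt0.
pose e' := e / (2 * (1 + y^-1)).
have e'0 : 0 < e' by rewrite divr_gt0// mulr_gt0.
have /cvgrPdist_lt /(_ _ e'0) := vu; apply: filterS => n.
rewrite sub0r normrN ger0_norm ?roughness_ge0// => dn.
have l2d : L2 (fun s => v n s - u s) by exact: L2B.
have [_ iu] := l2u; have [_ iv] := l2v n; have [_ id] := l2d.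
have key : `|roughness (v n) - roughness u| <=
    (1 + y^-1) * roughness (fun s => v n s - u s) + y * roughness u.
  rewrite /roughness -RintegralB// -!RintegralZl//.
  have i1 : lam.-integrable setT (fun x => ((1 + y^-1) * (v n x - u x) ^+ 2)%:E).
    by under eq_fun do rewrite EFinM; exact: integrableZl.
  have i2 : lam.-integrable setT (fun x => (y * u x ^+ 2)%:E).
    by under eq_fun do rewrite EFinM; exact: integrableZl.
  have i3 : lam.-integrable setT (fun x => (v n x ^+ 2 - u x ^+ 2)%:E).
    by under eq_fun do rewrite EFinB; exact: integrableB.
  rewrite -RintegralD//; apply: (le_trans (le_normr_Rintegral measurableT i3)).
  apply: le_Rintegral => //.
  - exact: integrable_norm i3.
  - by rewrite /comp; under eq_fun do rewrite EFinD; exact: integrableD.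
  - move=> x _; set D := v n x - u x.
    have -> : v n x ^+ 2 - u x ^+ 2 = D ^+ 2 + 2 * (D * u x) by rewrite /D; ring.
    have h1 : 0 <= y * ((1 + y^-1) * D ^+ 2 + y * u x ^+ 2 - D ^+ 2 - 2 * (D * u x)).
      have -> : y * ((1 + y^-1) * D ^+ 2 + y * u x ^+ 2 - D ^+ 2 - 2 * (D * u x)) =
          (D - y * u x) ^+ 2 by field; rewrite gt_eqF.
      exact: sqr_ge0.
    have h2 : 0 <= y * ((1 + y^-1) * D ^+ 2 + y * u x ^+ 2 - D ^+ 2 + 2 * (D * u x)).
      have -> : y * ((1 + y^-1) * D ^+ 2 + y * u x ^+ 2 - D ^+ 2 + 2 * (D * u x)) =
          (D + y * u x) ^+ 2 by field; rewrite gt_eqF.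
      exact: sqr_ge0.
    rewrite !pmulr_rge0// in h1 h2.
    have := sqr_ge0 D; rewrite ler_norml => ?; apply/andP; split; lra.
rewrite distrC; apply: (le_lt_trans key).
have h1 : (1 + y^-1) * roughness (fun s => v n s - u s) < e / 2.
  by move: dn; rewrite /e' ltr_pdivlMr ?mulr_gt0//; lra.
have h2 : y * roughness u <= e / 2.
  rewrite /y invfM mulrA -[leRHS]mulr1 -mulrA ler_wpM2l ?divr_ge0 ?(ltW e0)//.
  by rewrite mulrC ler_pdivrMr ?mul1r; lra.
lra.
Qed.

(** Minkowski's inequality for averages: [corr c k u] minus the integral of k times u
    is an average of translation errors of u with weight k. *)
Lemma corr_dist_le c k u : L1 k -> L2 u ->
  roughness (fun s => corr c k u s - (\int[lam]_t k t) * u s) <=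
  (\int[lam]_t `|k t|) *
    \int[lam]_t (`|k t| * roughness (fun s => u (s + c * t) - u s)).
Proof.
move=> l1k l2u; have [mu iu] := l2u; have mk := L1_measurable l1k.
have l1n := L1_norm l1k.
set a := \int[lam]_t `|k t|; set a1 := \int[lam]_t k t.
have a0 : 0 <= a by exact: Rintegral_ge0.
pose F (z : mR * mR) := `|k z.2| * (u (z.1 + c * z.2) - u z.1) ^+ 2.
have mnk : measurable_fun setT (fun t : mR => `|k t|) by exact: measurableT_comp.
have mF : measurable_fun setT F.
  apply: measurable_funM; first exact: (measurableT_comp mnk measurable_snd).
  apply: measurable_funX; apply: measurable_funB.
    exact: (measurableT_comp mu (measurable_shear c)).
  exact: (measurableT_comp mu measurable_fst).
have iF : (lam \x lam)%E.-integrable setT (EFin \o F).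
  have i1 := integrable_sheared c l1n iu.
  have i2 := integrable_sheared 0 l1n iu.
  have i3 : (lam \x lam)%E.-integrable setT (fun z : mR * mR =>
      (2 * (`|k z.2| * u (z.1 + c * z.2) ^+ 2 + `|k z.2| * u (z.1 + 0 * z.2) ^+ 2))%:E).
    under eq_fun do rewrite EFinM; apply: integrableZl => //.
    by under eq_fun do rewrite EFinD; exact: integrableD.
  apply: (integrable_le mF i3) => z /=.
  have F0 : 0 <= F z by rewrite mulr_ge0// sqr_ge0.
  rewrite ger0_norm// mul0r addr0 /F -mulrDr [leRHS]mulrCA ler_wpM2l//.
  have := sqr_ge0 (u (z.1 + c * z.2) + u z.1); nra.
pose D s := \int[lam]_t (`|k t| * (u (s + c * t) - u s) ^+ 2).
have D0 s : 0 <= D s by apply: Rintegral_ge0 => *; rewrite mulr_ge0 ?sqr_ge0.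
have iD : lam.-integrable setT (EFin \o D) by exact: (integrable_Rintegral iF).
have mD : measurable_fun setT (D : mR -> R) by case/integrableP : iD => /measurable_EFinP.
have l2c := (corr_young c l1k l2u).1.
have [mE iE] : L2 (fun s => corr c k u s - a1 * u s) by apply: L2B => //; exact: L2Z.
have le : (\int[lam]_s ((corr c k u s - a1 * u s) ^+ 2)%:E <= \int[lam]_s (a * D s)%:E)%E.
  apply: ae_ge0_le_integral => //.
  - by move=> s _; rewrite lee_fin sqr_ge0.
  - by apply/measurable_EFinP; exact: measurable_funX.
  - by move=> s _; rewrite lee_fin mulr_ge0.
  - by apply/measurable_EFinP; exact: measurable_funM.
  apply: (ae_impl2 _ (ae_corr_integrable c l1k l2u) (ae_integrable1 iF)) => s ik iFs _.
  have iku : lam.-integrable setT (fun t => (k t * u s)%:E).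
    by under eq_fun do rewrite EFinM; exact: integrableZr.
  rewrite lee_fin /corr -RintegralZr// -RintegralB//.
  under [X in X ^+ 2]eq_Rintegral do rewrite -mulrBr.
  apply: weighted_cauchy_schwarz => //; apply: measurable_funB => //.
  exact: measurable_shear1.
have iaD : lam.-integrable setT (fun s => (a * D s)%:E).
  by under eq_fun do rewrite EFinM; exact: integrableZl.
have -> : a * \int[lam]_t (`|k t| * roughness (fun s => u (s + c * t) - u s)) =
    \int[lam]_s (a * D s).
  rewrite (RintegralZl a measurableT iD); congr (_ * _).
  rewrite /D (Rintegral_Fubini iF) /F/=; apply: eq_Rintegral => t _.
  by rewrite RintegralZl//; case: (L2B (L2_shift (c * t) l2u) l2u).
by rewrite /roughness /Rintegral fine_le//; exact: integrable_fin_num.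
Qed.

(** The averaged translation errors tend to 0 pointwise and are at most 4 R(u) |k|. *)
Lemma corr_approx_identity (b : nat -> R) k u : L1 k -> L2 u -> b @ \oo --> 0 ->
  (fun n => roughness (fun s => corr (b n) k u s - (\int[lam]_t k t) * u s))
    @ \oo --> 0.
Proof.
move=> l1k l2u b0.
pose W n t := `|k t| * roughness (fun s => u (s + b n * t) - u s).
have Wb n t : `|W n t| <= 4 * roughness u * `|k t|.
  rewrite /W ger0_norm ?mulr_ge0 ?roughness_ge0// mulrC ler_wpM2r//.
  have := roughnessB_le (L2_shift (b n * t) l2u) l2u.
  by rewrite roughness_shift//; lra.
have W0 : (fun n => \int[lam]_t W n t) @ \oo --> 0.
  apply: (Rintegral_dominated_cvg0 (G := fun t : mR => 4 * roughness u * `|k t|)) => //.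
  - move=> n; apply: measurable_funM.
      by apply: measurableT_comp => //; exact: L1_measurable.
    apply: (measurable_Rintegral lam (F := fun z : mR * mR => (u (z.2 + b n * z.1) - u z.2) ^+ 2)).
    have mu : measurable_fun setT (u : mR -> R) by case: l2u.
    apply: measurable_funX; apply: measurable_funB.
      apply: (measurableT_comp mu); apply: measurable_funD => //.
      exact: measurable_funM.
    exact: (measurableT_comp mu measurable_snd).
  - move=> t; rewrite -[X in _ --> X](mulr0 `|k t|); apply: cvgM; first exact: cvg_cst.
    apply: shift_continuous_L2 => //.
    by rewrite -[X in _ --> X](mul0r t); apply: cvgM => //; exact: cvg_cst.
  - under eq_fun do rewrite EFinM; apply: integrableZl => //; exact: L1_norm.
apply: (@squeeze_cvgr _ _ _ _ (cst 0) (fun n => (\int[lam]_t `|k t|) * \int[lam]_t W n t)).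
- by apply: nearW => n; rewrite roughness_ge0/=; exact: corr_dist_le.
- exact: cvg_cst.
- rewrite -[X in _ --> X](mulr0 (\int[lam]_t `|k t|)); apply: cvgM => //; exact: cvg_cst.
Qed.

End Translation.

(** * Explicit bump functions *)

Section Bump.
Context {R : realType}.
Local Notation lam := (@lebesgue_measure R).
Local Notation mR := (measurableTypeR R).

(** The factor x^-k is there for differentiation: the derivative of a flat function
    is again a combination of flat functions. *)
Definition flat (k : nat) (x : R) : R :=
  if 0 < x then x^-1 ^+ k * expR (- x^-1) else 0.

Lemma flat_ge0 k x : 0 <= flat k x.
Proof.
rewrite /flat; case: ifPn => // x0.
by rewrite mulr_ge0 ?expR_ge0// exprn_ge0// invr_ge0 ltW.
Qed.

(** This is the m-th power of y / m <= exp (y / m). *)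
Lemma expr_le_expR (m : nat) (y : R) : 0 <= y -> y ^+ m <= m%:R ^+ m * expR y.
Proof.
case: m => [|m] y0; first by rewrite !expr0 mul1r -expR0 ler_expR.
have m0 : 0 < m.+1%:R :> R by rewrite ltr0n.
have {1}-> : y = m.+1%:R * (y / m.+1%:R) by field; rewrite gt_eqF.
have {2}-> : y = m.+1%:R * (y / m.+1%:R) by field; rewrite gt_eqF.
rewrite expRM_natl exprMn ler_wpM2l ?exprn_ge0 ?ler0n//.
rewrite lerXn2r ?nnegrE ?expR_ge0 ?divr_ge0// ?ler0n//.
by apply: le_trans (expR_ge1Dx _); rewrite lerDr.
Qed.

(** Flatness at 0 to every order. For m = 2 it yields differentiability there, for
    m = 0 boundedness. *)
Lemma flat_le_pow k m : exists2 C : R, 0 <= C & forall x, flat k x <= C * `|x| ^+ m.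
Proof.
exists ((k + m)%:R ^+ (k + m)); first by rewrite exprn_ge0.
move=> x; rewrite /flat; case: ifPn => x0; last first.
  by rewrite mulr_ge0// exprn_ge0.
have y0 : 0 < x^-1 by rewrite invr_gt0.
rewrite gtr0_norm// expRN ler_pdivrMr ?expR_gt0// mulrAC.
have := expr_le_expR (k + m) (ltW y0); rewrite exprD => h.
by rewrite -ler_pdivrMr ?exprn_gt0// -exprVn.
Qed.

Lemma flat_derive k (x : R) :
  is_derive x 1 (flat k) (- k%:R * flat k.+1 x + flat k.+2 x).
Proof.
have [x0|x0|->] := ltgtP x 0.
- rewrite /flat ltNge (ltW x0)/= !mulr0 addr0.
  apply: (near_eq_is_derive _ (is_derive_cst 0 x 1)).
  near=> y; have y0 : y < 0 by near: y; exact: lt_nbhsl.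
  by rewrite ltNge (ltW y0).
- have xn0 : x != 0 by rewrite gt_eqF.
  apply: (near_eq_is_derive (f := fun y : R => y^-1 ^+ k * expR (- y^-1))).
    near=> y; have y0 : 0 < y by near: y; exact: lt_nbhsr.
    by rewrite /flat y0.
  have dV : is_derive x 1 (fun y : R => y^-1) (- x ^- 2).
    by have := is_deriveV xn0 (is_derive_id x 1); rewrite /GRing.scale/= mulr1.
  have dE : is_derive x 1 (fun y => expR (- y^-1)) (expR (- x^-1) * (x ^- 2)).
    apply: (is_derive1_comp (f := expR) (g := fun y => - y^-1)).
    by have := is_deriveN dV; rewrite opprK.
  have dX : is_derive x 1 (fun y : R => y^-1 ^+ k)
      ((k%:R * x^-1 ^+ k.-1) *: (- x ^- 2)).
    by have := is_deriveX k dV; rewrite exprfctE.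
  apply: (is_derive_eq (is_deriveM dX dE)); rewrite /flat x0 /GRing.scale/=.
  rewrite -!exprVn; case: k dX => [|m] _ /=; rewrite ?exprS ?expr0; ring.
- rewrite /flat ltxx !mulr0 addr0.
  have [C C0 hC] := flat_le_pow k 2.
  suff H : h^-1 *: (flat k (h *: 1 + 0) - flat k 0) @[h --> 0^'] --> (0 : R).
    split; first by apply/cvg_ex; exists 0.
    exact: (cvg_lim _ H).
  apply/cvgrPdist_lt => e e0; near=> h.
  rewrite sub0r normrN /GRing.scale/= mulr1 addr0 {2}/flat ltxx subr0 normrM normfV.
  have h0 : h != 0 by near: h; exact: nbhs_dnbhs_neq.
  have hp : 0 < `|h| by rewrite normr_gt0.
  rewrite mulrC ltr_pdivrMr// (ger0_norm (flat_ge0 _ _)) (le_lt_trans (hC h))//.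
  rewrite expr2 mulrA ltr_pM2r//.
  have hs : `|h| < e / (C + 1).
    near: h; apply: dnbhs0_lt; by rewrite divr_gt0// ltr_wpDl.
  rewrite (@le_lt_trans _ _ ((C + 1) * `|h|))//; first by rewrite ler_wpM2r// lerDl.
  by rewrite mulrC -ltr_pdivlMr// ltr_wpDl.
Unshelve. all: by end_near. Qed.

(** Products of a left and a right flat function vanish outside an interval, and
    with their linear combinations they are closed under differentiation. Hence they
    are smooth with no need for a general theory of smooth functions, and they are
    test functions when the slope c is not 0. The class is also closed under affine
    substitutions, which keeps translates and dilates available as test functions. *)
Inductive bump (c p q : R) : (R -> R) -> Prop :=
| bump_gen j k : bump c p q (fun x => flat j (c * x + p) * flat k (q - c * x))
| bump_lin a1 a2 f1 f2 : bump c p q f1 -> bump c p q f2 ->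
    bump c p q (fun x => a1 * f1 x + a2 * f2 x).

Lemma bump_is_derive c p q f : bump c p q f ->
  exists2 f', bump c p q f' & forall x : R, is_derive x 1 f (f' x).
Proof.
elim=> [j k|a1 a2 f1 f2 _ [f1' b1 d1] _ [f2' b2 d2]].
  pose G i l x := flat i (c * x + p) * flat l (q - c * x).
  exists (fun x => c * (- j%:R * G j.+1 k x + 1 * G j.+2 k x) +
                   (- c) * (- k%:R * G j k.+1 x + 1 * G j k.+2 x)).
    by do 2! apply: bump_lin; exact: bump_gen.
  move=> x.
  have dc : is_derive x 1 (fun x => c * x) c.
    by have := is_deriveZ c (is_derive_id x 1); rewrite /GRing.scale/= mulr1.
  have dl : is_derive x 1 (fun x => c * x + p) c.
    by have := is_deriveD dc (is_derive_cst p x 1); rewrite addr0.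
  have dr : is_derive x 1 (fun x => q - c * x) (- c).
    by have := is_deriveB (is_derive_cst q x 1) dc; rewrite sub0r.
  have h1 := is_derive1_comp (g := fun x : R => c * x + p) (flat_derive j (c * x + p)) dl.
  have h2 := is_derive1_comp (g := fun x : R => q - c * x) (flat_derive k (q - c * x)) dr.
  apply: (is_derive_eq (is_deriveM h1 h2)).
  rewrite /GRing.scale/= /G; ring.
exists (fun x => a1 * f1' x + a2 * f2' x); first exact: bump_lin.
by move=> x; exact: is_deriveD (is_deriveZ a1 (d1 x)) (is_deriveZ a2 (d2 x)).
Qed.

Lemma bump_derive1n c p q f n : bump c p q f -> bump c p q (derive1n n f).
Proof.
elim: n => [//|n IH] /IH /bump_is_derive [f' bf' df'].
rewrite (_ : derive1n n.+1 f = f')//; apply/funext => x.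
by rewrite /= derive1E; case: (df' x).
Qed.

Lemma bump_derivable c p q f (x : R) : bump c p q f -> derivable f x 1.
Proof. by move=> /bump_is_derive [f' _ /(_ x)] []. Qed.

Lemma bump_continuous c p q f : bump c p q f -> continuous f.
Proof.
move=> bf x; apply: differentiable_continuous; apply/derivable1_diffP.
exact: bump_derivable bf.
Qed.

Lemma bump_affine c p q a e f : bump c p q f ->
  bump (c * e) (c * a + p) (q - c * a) (fun x => f (a + e * x)).
Proof.
elim=> [j k|a1 a2 f1 f2 _ b1 _ b2]; last exact: bump_lin.
rewrite (_ : (fun x => _) = fun x => flat j (c * e * x + (c * a + p)) *
  flat k ((q - c * a) - c * e * x)); first exact: bump_gen.
by apply/funext => x; congr (flat _ _ * flat _ _); ring.
Qed.

Lemma bump_bounded c p q f : bump c p q f -> exists M, forall x, `|f x| <= M.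
Proof.
elim=> [j k|a1 a2 f1 f2 _ [M1 h1] _ [M2 h2]].
  have [C1 _ hC1] := flat_le_pow j 0; have [C2 _ hC2] := flat_le_pow k 0.
  exists (C1 * C2) => x; rewrite normrM !(ger0_norm (flat_ge0 _ _)).
  rewrite ler_pM ?flat_ge0//; [have := hC1 (c * x + p)|have := hC2 (q - c * x)];
    by rewrite expr0 mulr1.
exists (`|a1| * M1 + `|a2| * M2) => x; rewrite (le_trans (ler_normD _ _))//.
by rewrite !normrM lerD// ler_wpM2l.
Qed.

(** With a nonzero slope, at any point far from the origin one of the two factors has
    a negative argument. *)
Lemma bump_support c p q f : c != 0 -> bump c p q f ->
  forall x, (`|p| + `|q|) / `|c| < `|x| -> f x = 0.
Proof.
move=> c0; elim=> [j k|a1 a2 f1 f2 _ h1 _ h2] x hx; last first.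
  by rewrite h1// h2// !mulr0 addr0.
have : `|p| + `|q| < `|c * x| by rewrite normrM mulrC -ltr_pdivrMr ?normr_gt0.
have := ler_norm p; have := ler_norm q; have := ler_norm (- p); have := ler_norm (- q).
rewrite !normrN /flat; case: ifP => h; rewrite ?mul0r//; case: ifP => h'; rewrite ?mulr0//.
by case: (lerP 0 (c * x)) => s; [rewrite (ger0_norm s)|rewrite (ltr0_norm s)]; lra.
Qed.

Lemma bump_L2 c p q f : c != 0 -> bump c p q f -> L2 f.
Proof.
move=> c0 bf; have [M hM] := bump_bounded bf.
by have [] := shift_continuous_Cc (bump_continuous bf) hM (bump_support c0 bf).
Qed.

Lemma bump_test c p q f : c != 0 -> bump c p q f -> test_function f.
Proof.
move=> c0 bf; split; first by move=> n x; exact: bump_derivable (bump_derive1n n bf).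
have hs := bump_support c0 bf; set B := _ / _ in hs.
have sub : closure [set x | f x != 0] `<=` `[- B, B]%classic.
  rewrite [X in _ `<=` X](closure_id _).1; last exact: interval_closed.
  apply: closure_subset => x /= fx; rewrite in_itv/=.
  have : `|x| <= B by rewrite leNgt; apply/negP => /hs fx0; rewrite fx0 eqxx in fx.
  by rewrite ler_norml.
apply: (subclosed_compact _ (@segment_compact _ (- B) B) sub).
exact: closed_closure.
Qed.

Lemma derive1n2_affine c p q f a e : bump c p q f ->
  derive1n 2 (fun x => f (a + e * x)) = fun x => e ^+ 2 * derive1n 2 f (a + e * x).
Proof.
have D g : bump c p q g -> derive1 (fun x => g (a + e * x)) = fun x => e * derive1 g (a + e * x).
  move=> bg; apply/funext => x; rewrite !derive1E.
  have dc : is_derive x 1 (fun x => a + e * x) e.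
    have := is_deriveD (is_derive_cst a x 1) (is_deriveZ e (is_derive_id x 1)).
    by rewrite /GRing.scale/= add0r mulr1.
  have dg : is_derive (a + e * x) 1 g ('D_1 g (a + e * x)).
    by apply: DeriveDef => //; exact: bump_derivable bg.
  have := is_derive1_comp (g := fun x => a + e * x) dg dc => -[_ dE].
  by rewrite mulrC -dE.
move=> bf; apply/funext => x; rewrite /= D// derive1E.
have b1 := bump_derive1n 1 bf.
have db : derivable (fun x => (derive1 f) (a + e * x)) x 1.
  exact: bump_derivable (bump_affine a e b1).
rewrite (@deriveZ _ _ _ (fun x => (derive1 f) (a + e * x)) _ _ _ db).
by rewrite -derive1E (D (derive1 f))// /GRing.scale/= mulrA -expr2.
Qed.

Definition unit_bump : R -> R := fun x => flat 0 (1 * x + 1) * flat 0 (1 - 1 * x).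

Lemma bump_unit_bump : bump 1 1 1 unit_bump. Proof. exact: bump_gen. Qed.

Lemma L1_unit_bump : L1 unit_bump.
Proof.
have [M hM] := bump_bounded bump_unit_bump.
apply: (integrable_bounded_support _ hM (bump_support (oner_neq0 _) bump_unit_bump)).
by case: (bump_L2 (oner_neq0 _) bump_unit_bump).
Qed.

(** Not being 0 is what lets [unit_bump] generate an approximate identity. On [0, 1/2]
    both arguments of the exponentials are at least -2. *)
Lemma Rintegral_unit_bump_gt0 : 0 < \int[lam]_t unit_bump t.
Proof.
pose I : set mR := `[0, 2^-1]%classic.
have c0 : 0 < expR (-2) ^+ 2 * 2^-1 :> R by rewrite mulr_gt0 ?exprn_gt0 ?expR_gt0.
apply: (lt_le_trans c0).
have -> : expR (-2) ^+ 2 * 2^-1 = \int[lam]_t (expR (-2) ^+ 2 * \1_I t) :> R.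
  rewrite RintegralZl//; last exact: (integrable_indic_itv _ _ true false).
  congr (_ * _); rewrite /Rintegral integral_indic//; last exact: measurable_itv.
  have lI : lam I = (2^-1)%:E.
    by rewrite lebesgue_measure_itv/= lte_fin invr_gt0 ltr0n/= -EFinB subr0.
  by rewrite setIT; exact: (esym (congr1 fine lI)).
apply: le_Rintegral => //; last 2 first.
- exact: L1_unit_bump.
- move=> x _; rewrite indicE; have [|] := boolP (x \in I); last first.
    by rewrite mulr0 mulr_ge0 ?flat_ge0.
  rewrite inE /I/= in_itv/= mulr1 => /andP[x0 x1].
  have h y : 2^-1 <= y -> expR (-2) <= flat 0 y.
    move=> hy; have y0 : 0 < y by rewrite (lt_le_trans _ hy).
    rewrite /flat y0 expr0 mul1r ler_expR lerN2 -(invrK 2) lef_pV2 ?posrE//.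
  rewrite expr2 /unit_bump !mul1r ler_pM ?expR_ge0// h//; lra.
- rewrite /comp; under eq_fun do rewrite EFinM; apply: integrableZl => //.
  exact: (integrable_indic_itv _ _ true false).
Qed.

End Bump.

(** * Weak derivatives and correlations *)

Section WeakDerivativeSmoothing.
Context {R : realType}.
Local Notation lam := (@lebesgue_measure R).
Local Notation mR := (measurableTypeR R).
Implicit Types f ddf L ddL g u phi : R -> R.

Lemma Rintegral_mul_shift h phi u : L2 phi -> L2 u ->
  \int[lam]_s (phi s * u (s + h)) = \int[lam]_s (u s * phi (s - h)).
Proof.
move=> l2p l2u; rewrite -(Rintegral_shift (- h)); last exact: (L2_mul l2p (L2_shift _ l2u)).
by apply: eq_Rintegral => s _; rewrite subrK mulrC.
Qed.

Lemma corr_adjoint c k phi u : L1 k -> L2 phi -> L2 u ->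
  \int[lam]_s (phi s * corr c k u s) = \int[lam]_s (u s * corr (- c) k phi s).
Proof.
move=> l1k l2p l2u.
rewrite (corr_swap c l1k l2p l2u) (corr_swap (- c) l1k l2u l2p).
by apply: eq_Rintegral => t _; rewrite Rintegral_mul_shift// mulNr.
Qed.

Lemma cvg_cst_eq (a l : R) : (fun _ : nat => a) @ \oo --> l -> l = a.
Proof.
by move=> h; exact: (cvg_unique (@norm_hausdorff _ R^o) h (cvg_cst a)).
Qed.

(** Every value of a smoothing of u by [unit_bump] is a pairing of u with a rescaled
    bump, hence 0, while the smoothings tend in L2 to a nonzero multiple of u. *)
Lemma roughness_eq0_bump u : L2 u -> (forall c p q phi, c != 0 -> bump c p q phi ->
  \int[lam]_x (phi x * u x) = 0) -> roughness u = 0.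
Proof.
move=> l2u h.
pose I := \int[lam]_t unit_bump t : R; have I0 : 0 < I := Rintegral_unit_bump_gt0.
pose e (n : nat) : R := n.+1%:R^-1.
have e0 : e @ \oo --> 0 by exact: cvg_harmonic.
have corr0 n s : corr (e n) unit_bump u s = 0.
  have en0 : e n != 0 by rewrite invr_neq0// pnatr_eq0.
  have b1 : bump (1 * (e n)^-1) (1 * (- (s / e n)) + 1) (1 - 1 * (- (s / e n)))
      (fun x => unit_bump (- (s / e n) + (e n)^-1 * x)) by exact: bump_affine bump_unit_bump.
  have c0 : 1 * (e n)^-1 != 0 by rewrite mul1r invr_neq0.
  have := h _ _ _ _ c0 b1.
  have iv := L2_mul (bump_L2 c0 b1) l2u.
  have := Rintegral_affine s en0 iv.
  move=> + E0; rewrite E0 mulr0 => E.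
  rewrite /corr -[RHS]E; apply: eq_Rintegral => t _; congr (unit_bump _ * _).
  by field.
have := corr_approx_identity L1_unit_bump l2u e0.
under eq_fun do under eq_fun do rewrite corr0 sub0r -mulNr.
under eq_fun do rewrite roughnessZ// sqrrN.
move=> /cvg_cst_eq /esym /eqP.
by rewrite mulf_eq0 expf_eq0/= gt_eqF//= => /eqP.
Qed.

Section Pairing.
Variables (L ddL f ddf : R -> R).
Hypotheses (l1L : L1 L) (l1ddL : L1 ddL) (l2f : L2 f) (l2ddf : L2 ddf).
Hypotheses (wL : weak_derive2 L ddL) (wf : weak_derive2 f ddf).

(** The function t |-> phi (x + b t) is a test function, with second derivative
    b^2 phi'' (x + b t). *)
Lemma corr_weak_bump b c p q phi x : b != 0 -> c != 0 -> bump c p q phi ->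
  corr b ddL phi x = b ^+ 2 * corr b L (derive1n 2 phi) x.
Proof.
move=> b0 c0 bp; have ba := bump_affine x b bp.
have cb : c * b != 0 by rewrite mulf_neq0.
have [_ _ H] := wL; rewrite /corr (H _ (bump_test cb ba)).
have bp2 := bump_derive1n 2 bp.
have l2p2 : L2 (fun t => derive1n 2 phi (x + b * t)) by exact: L2_affine (bump_L2 c0 bp2).
rewrite (derive1n2_affine x b bp); under eq_Rintegral do rewrite mulrCA.
rewrite RintegralZl//.
have [M hM] := bump_bounded bp2.
have M0 : 0 <= M by exact: le_trans (hM 0).
apply: (integrable_le (w := fun t : mR => M * `|L t|)).
- by apply: measurable_funM; [exact: L1_measurable|case: l2p2].
- by under eq_fun do rewrite EFinM; apply: integrableZl => //; exact: L1_norm.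
- by move=> t; rewrite normrM mulrC ler_wpM2r.
Qed.

(** By adjointness the smoothing by L'' acts on phi, and the two derivatives pass from
    L to phi; a second exchange of integrals lets them pass from phi to f. *)
Lemma corr_weak_pairing b c p q phi : b != 0 -> c != 0 -> bump c p q phi ->
  \int[lam]_s (phi s * corr b ddL f s) = b ^+ 2 * \int[lam]_s (phi s * corr b L ddf s).
Proof.
move=> b0 c0 bp; have l2p := bump_L2 c0 bp.
have nb0 : - b != 0 by rewrite oppr_eq0.
have bp2 := bump_derive1n 2 bp; have l2p2 := bump_L2 c0 bp2.
rewrite corr_adjoint//.
under eq_Rintegral do rewrite (corr_weak_bump _ nb0 c0 bp) sqrrN mulrCA.
rewrite (RintegralZl _ measurableT (L2_mul l2f (corr_young (- b) l1L l2p2).1)).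
congr (_ * _); rewrite (corr_swap (- b) l1L l2f l2p2) (corr_swap b l1L l2p l2ddf).
apply: eq_Rintegral => t _; congr (_ * _).
rewrite [RHS]Rintegral_mul_shift//.
have ba := bump_affine (- (b * t)) 1 bp.
have c1 : c * 1 != 0 by rewrite mulr1.
have [_ _ H] := wf.
transitivity (\int[lam]_x (ddf x * phi (- (b * t) + 1 * x))).
  rewrite (H _ (bump_test c1 ba)) (derive1n2_affine _ _ bp).
  by apply: eq_Rintegral => s _; rewrite expr1n !mul1r mulNr addrC.
by apply: eq_Rintegral => s _; rewrite mul1r addrC.
Qed.

(** Tested against bumps the two functions agree, so they are equal in L2. *)
Lemma roughness_corr_weak b : b != 0 ->
  roughness (fun s => b ^- 2 * corr b ddL f s) = roughness (corr b L ddf).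
Proof.
move=> b0.
have l2A : L2 (fun s => b ^- 2 * corr b ddL f s).
  by apply: L2Z; exact: (corr_young b l1ddL l2f).1.
have l2B : L2 (corr b L ddf) := (corr_young b l1L l2ddf).1.
have AB0 : roughness (fun s => b ^- 2 * corr b ddL f s - corr b L ddf s) = 0.
  apply: roughness_eq0_bump; first exact: L2B.
  move=> c p q phi c0 bp; have l2p := bump_L2 c0 bp.
  under eq_Rintegral do rewrite mulrBr mulrCA.
  have i1 := L2_mul l2p (corr_young b l1ddL l2f).1.
  have i2 := L2_mul l2p l2B.
  have i1' : lam.-integrable setT (fun x => (b ^- 2 * (phi x * corr b ddL f x))%:E).
    by under eq_fun do rewrite EFinM; exact: integrableZl.
  rewrite RintegralB//.
  rewrite RintegralZl// (corr_weak_pairing b0 c0 bp) mulrA mulVf ?mul1r ?subrr//.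
  by rewrite expf_eq0.
have := @roughness_cvg _ (fun n => fun s => b ^- 2 * corr b ddL f s) _ (fun=> l2A) l2B.
rewrite AB0 => /(_ (@cvg_cst _ _ _ _ _)) H.
exact/esym/cvg_cst_eq.
Qed.

End Pairing.

(** * Smoothing by an autocorrelation *)

Section Autocorrelation.
Variables (g : R -> R).
Hypotheses (l1g : L1 g) (l2g : L2 g).

Lemma autocorrelationE : autocorrelation g = corr 1 g g.
Proof. by apply/funext => z; apply: eq_Rintegral => y _; rewrite mul1r addrC. Qed.

Lemma autocorrelation_even z : autocorrelation g (- z) = autocorrelation g z.
Proof.
rewrite /autocorrelation Rintegral_mul_shift//.
by apply: eq_Rintegral => y _; rewrite opprK.
Qed.

Lemma autocorrelation_bounded z : `|autocorrelation g z| <= roughness g.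
Proof.
have [_ ig] := l2g.
have i1 := L2_mul l2g (L2_shift z l2g).
have [_ i2] := L2_shift z l2g.
apply: (le_trans (le_normr_Rintegral measurableT i1)).
have -> : roughness g = 2^-1 * (roughness g + roughness (fun y => g (y + z))).
  by rewrite roughness_shift//; field.
have iS : lam.-integrable setT (fun y => (g y ^+ 2 + g (y + z) ^+ 2)%:E).
  by under eq_fun do rewrite EFinD; exact: integrableD.
rewrite /roughness -RintegralD// -RintegralZl//; apply: le_Rintegral => //.
- exact: integrable_norm i1.
- by rewrite /comp; under eq_fun do rewrite EFinM; exact: integrableZl.
- move=> y _; have := sqr_ge0 (g y - g (y + z)); have := sqr_ge0 (g y + g (y + z)).
  by rewrite ler_norml => ? ?; apply/andP; split; nra.
Qed.

(** Substituting y = x + b z turns the smoothing of [f] by the autocorrelation of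
    [g] into two successive smoothings by [g]. *)
Lemma Rintegral_autocorrelation b f x : 0 < b -> L2 f ->
  \int[lam]_y (autocorrelation g ((x - y) / b) * f y) =
  b * corr (- b) g (corr b g f) x.
Proof.
move=> b0 l2f; have bn0 : b != 0 by rewrite gt_eqF.
have l2G : L2 (autocorrelation g).
  by rewrite autocorrelationE; exact: (corr_young 1 l1g l2g).1.
have l2Ga : L2 (fun y => autocorrelation g (x / b + (- b^-1) * y)).
  by apply: L2_affine => //; rewrite oppr_eq0 invr_eq0.
have iv := L2_mul l2Ga l2f.
have := Rintegral_affine x bn0 iv; rewrite (gtr0_norm b0) => E.
transitivity (\int[lam]_y (autocorrelation g (x / b + (- b^-1) * y) * f y)).
  by apply: eq_Rintegral => y _; congr (autocorrelation g _ * _); field.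
apply: (mulfI (invr_neq0 bn0)); rewrite -E mulKf//.
transitivity (\int[lam]_z (f (x + b * z) * corr 1 g g z)).
  apply: eq_Rintegral => z _; rewrite mulrC -autocorrelationE -[in RHS]autocorrelation_even.
  by congr (_ * autocorrelation g _); field.
rewrite (corr_swap 1 l1g (L2_affine x bn0 l2f) l2g).
apply: eq_Rintegral => t _; congr (_ * _); rewrite Rintegral_mul_shift//; last exact: L2_affine.
by apply: eq_Rintegral => z _; congr (_ * f _); ring.
Qed.

Lemma L2_Rintegral_autocorrelation b f : 0 < b -> L2 f ->
  L2 (fun x => \int[lam]_y (autocorrelation g ((x - y) / b) * f y)).
Proof.
move=> b0 l2f.
have -> : (fun x => \int[lam]_y (autocorrelation g ((x - y) / b) * f y)) =
    fun x => b * corr (- b) g (corr b g f) x.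
  by apply/funext => x; exact: Rintegral_autocorrelation.
by apply: L2Z; apply: (corr_young _ _ _).1 => //; exact: (corr_young _ _ _).1.
Qed.

(** Smoothing at scales b and -b are adjoint, so pairing with f yields a squared
    norm. *)
Lemma Rintegral2_autocorrelation b f : 0 < b -> L2 f ->
  \int[lam]_x (f x * \int[lam]_y (autocorrelation g ((x - y) / b) * f y)) =
  b * roughness (corr b g f).
Proof.
move=> b0 l2f; have l2C := (corr_young b l1g l2f).1.
under eq_Rintegral do rewrite Rintegral_autocorrelation// mulrCA.
rewrite (RintegralZl _ measurableT (L2_mul l2f (corr_young (- b) l1g l2C).1)).
rewrite (corr_adjoint (- b) l1g l2f l2C) opprK /roughness.
by under [in RHS]eq_Rintegral do rewrite expr2.
Qed.

Lemma roughness_Rintegral_autocorrelation b f : 0 < b -> L2 f ->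
  roughness (fun x => \int[lam]_y (autocorrelation g ((x - y) / b) * f y)) <=
  b ^+ 2 * (\int[lam]_t `|g t|) ^+ 2 * roughness (corr b g f).
Proof.
move=> b0 l2f; have l2C := (corr_young b l1g l2f).1.
have -> : (fun x => \int[lam]_y (autocorrelation g ((x - y) / b) * f y)) =
    fun x => b * corr (- b) g (corr b g f) x.
  by apply/funext => x; exact: Rintegral_autocorrelation.
have [l2D yD] := corr_young (- b) l1g l2C.
rewrite (roughnessZ b l2D) -mulrA; apply: ler_wpM2l yD; exact: sqr_ge0.
Qed.

End Autocorrelation.
End WeakDerivativeSmoothing.

(** * Bounded functions on probability spaces *)

Section BoundedIntegrands.
Context {R : realType}.

Lemma integrable_bounded d (T : measurableType d) (m : probability T R)
  (v : T -> R) (M : R) : measurable_fun setT v -> (forall x, `|v x| <= M) ->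
  m.-integrable setT (fun x => (v x)%:E).
Proof.
move=> mv vM; apply: (integrable_le (w := fun=> M)) => //.
exact: finite_measure_integrable_cst.
Qed.

Lemma Rintegral_probability_cst d (T : measurableType d) (m : probability T R) (c : R) :
  \int[m]_x c = c.
Proof.
have E := probability_setT m.
by rewrite Rintegral_cst// [X in fine X]E mulr1.
Qed.

(** The product measure packaged as a probability, so that results on bounded
    functions apply to it. *)
Definition pprod d1 d2 (T1 : measurableType d1) (T2 : measurableType d2)
  (m1 : probability T1 R) (m2 : probability T2 R) : probability (T1 * T2)%type R :=
  (m1 \x m2)%E.

Lemma pprod_rect d1 d2 (T1 : measurableType d1) (T2 : measurableType d2)
  (m1 : probability T1 R) (m2 : probability T2 R) A B :
  measurable A -> measurable B -> pprod m1 m2 (A `*` B) = (m1 A * m2 B)%E.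
Proof. exact: product_measure1E. Qed.

Lemma Rintegral_pprod d1 d2 (T1 : measurableType d1) (T2 : measurableType d2)
  (m1 : probability T1 R) (m2 : probability T2 R) (F : T1 * T2 -> R) (M : R) :
  measurable_fun setT F -> (forall z, `|F z| <= M) ->
  \int[pprod m1 m2]_z F z = \int[m1]_x \int[m2]_y F (x, y).
Proof.
move=> mF FM.
have iF : (pprod m1 m2).-integrable setT (EFin \o F) by exact: integrable_bounded FM.
exact: (@Rintegral_prod _ _ _ _ _ m1 m2 F iF).
Qed.

End BoundedIntegrands.

(** * Joint laws of independent pairs *)

Section JointLaw.
Context d (T : measurableType d) (R : realType) (P : probability T R).

Lemma measure_rect_unique d1 d2 (T1 : measurableType d1) (T2 : measurableType d2)
    (m1 m2 : {measure set (T1 * T2) -> \bar R}) :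
  (m1 setT < +oo)%E ->
  (forall A B, measurable A -> measurable B -> m1 (A `*` B) = m2 (A `*` B)) ->
  forall C, measurable C -> m1 C = m2 C.
Proof.
move=> m1oo mE C mC.
pose G : set (set (T1 * T2)) := [set A `*` B | A in measurable & B in measurable].
apply: (measure_unique G (fun=> setT)) => //.
- exact: measurable_prod_measurableType.
- move=> _ _ [A1 mA1 [B1 mB1 <-]] [A2 mA2 [B2 mB2 <-]].
  rewrite -setXI; exists (A1 `&` A2); first exact: measurableI.
  by exists (B1 `&` B2) => //; exact: measurableI.
- by move=> _; exists setT => //; exists setT => //; exact: setXTT.
- by rewrite bigcup_const//; exists 0%N.
- by move=> _ [A mA [B mB <-]]; exact: mE.
Qed.

(** Rectangles generate the product sigma-algebra, and both sides are finite measures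
    in C. *)
Lemma rect_independent d1 d2 (T1 : measurableType d1) (T2 : measurableType d2)
    (Y : T -> T1 * T2) (m : probability (T1 * T2)%type R) (E : set T) :
  measurable_fun setT Y -> measurable E ->
  (forall A B, measurable A -> measurable B ->
    P (Y @^-1` (A `*` B) `&` E) = (m (A `*` B) * P E)%E) ->
  forall C, measurable C -> P (Y @^-1` C `&` E) = (m C * P E)%E.
Proof.
move=> mY mE h C mC.
have PE0 : 0 <= fine (P E) by rewrite fine_ge0.
have PEK : (fine (P E))%:E = P E by rewrite fineK// fin_num_measure.
pose m1 : {measure set (T1 * T2) -> \bar R} := mscale (NngNum PE0) m.
pose m2 : {measure set (T1 * T2) -> \bar R} :=
  measure_function_pushforward__canonical__measure_function_Measure
    (mrestr P mE) mY.
have m1E D : m1 D = (m D * P E)%E by rewrite /m1 /= /mscale /= PEK muleC.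
have m2E D : m2 D = P (Y @^-1` D `&` E) by [].
rewrite -m1E -m2E; apply/esym; apply: measure_rect_unique mC.
- by rewrite m1E probability_setT mul1e -PEK ltry.
- by move=> A B mA mB; rewrite m1E m2E h.
Qed.

Context dS (S : measurableType dS) (mu : probability S R).

(** Each of the four variables has law mu, as taking the other three sets to be full
    shows. The conjuncts are grouped for the passage to pairs. *)
Definition independent4 (X1 X2 X3 X4 : T -> S) :=
  forall A B C D, measurable A -> measurable B -> measurable C -> measurable D ->
  P (X1 @^-1` A `&` X2 @^-1` B `&` (X3 @^-1` C `&` X4 @^-1` D)) =
  (mu A * mu B * (mu C * mu D))%E.

Variables (X1 X2 X3 X4 : T -> S).
Hypotheses (mX1 : measurable_fun setT X1) (mX2 : measurable_fun setT X2).
Hypotheses (mX3 : measurable_fun setT X3) (mX4 : measurable_fun setT X4).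
Hypothesis iX : independent4 X1 X2 X3 X4.

Local Notation m := (pprod mu mu).
Let Y1 w := (X1 w, X2 w).
Let Y2 w := (X3 w, X4 w).
Let mY1 : measurable_fun setT Y1. Proof. exact: measurable_fun_pair. Qed.
Let mY2 : measurable_fun setT Y2. Proof. exact: measurable_fun_pair. Qed.

Let mpre (U : T -> S) A : measurable_fun setT U -> measurable A -> measurable (U @^-1` A).
Proof. by move=> mU mA; rewrite -[X in measurable X]setTI; exact: mU. Qed.

Let Y1_E A C D : measurable A -> measurable C -> measurable D ->
  P (Y1 @^-1` A `&` (X3 @^-1` C `&` X4 @^-1` D)) = (m A * (mu C * mu D))%E.
Proof.
move=> mA mC mD.
have PE : P (X3 @^-1` C `&` X4 @^-1` D) = (mu C * mu D)%E.
  have := iX measurableT measurableT mC mD.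
  by rewrite !preimage_setT !setTI !probability_setT !mul1e.
rewrite -PE; apply: (rect_independent (m := m)) => //.
  by apply: measurableI; exact: mpre.
move=> A' B mA' mB; rewrite PE pprod_rect// -iX//.
Qed.

(** Rectangles are replaced by arbitrary sets in one pair of variables, then in the
    other. *)
Lemma pairs_independent A B : measurable A -> measurable B ->
  P (Y1 @^-1` A `&` Y2 @^-1` B) = (m A * m B)%E.
Proof.
move=> mA mB.
have PE : P (Y1 @^-1` A) = m A.
  have := Y1_E mA measurableT measurableT.
  by rewrite !preimage_setT !setIT !probability_setT !mule1.
rewrite setIC muleC -PE; apply: (rect_independent (m := m)) => //.
  by rewrite -[X in measurable X]setTI; exact: mY1.
move=> C D mC mD; rewrite PE pprod_rect// muleC -Y1_E// setIC.
by [].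
Qed.

Lemma Rintegral_joint_law (F : (S * S) * (S * S) -> R) (M : R) :
  measurable_fun setT F -> (forall z, `|F z| <= M) ->
  \int[P]_w F ((X1 w, X2 w), (X3 w, X4 w)) = \int[m]_u \int[m]_v F (u, v).
Proof.
move=> mF FM.
have mY : measurable_fun setT (fun w => (Y1 w, Y2 w)) by exact: measurable_fun_pair.
have mE : measurable_fun setT (EFin \o F) by exact/measurable_EFinP.
have iP : P.-integrable setT (fun w => (F (Y1 w, Y2 w))%:E).
  by apply: (@integrable_bounded _ _ _ _ _ (M)) => //; exact: measurableT_comp mY.
rewrite -(Rintegral_pprod _ _ mF FM) /Rintegral; congr fine.
have := integral_pushforward mY mE iP measurableT => <-.
apply: eq_measure_integral => A mA _.
apply/esym; apply: measure_rect_unique mA.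
  by apply: (@le_lt_trans _ _ 1%E); [exact: probability_le1|exact: ltry].
move=> B C mB mC; transitivity (m B * m C)%E; first exact: pprod_rect.
by rewrite -pairs_independent.
Qed.

End JointLaw.

(** * The second moment of a U-statistic *)

Section Ustatistic.
Context d (T : measurableType d) (R : realType) (P : probability T R).
Context dS (S : measurableType dS) (mu : probability S R).

Lemma Rintegral_sum d' (T' : measurableType d') (m : {measure set T' -> \bar R})
  (I : Type) (s : seq I) (Q : pred I) (F : I -> T' -> R) :
  (forall i, m.-integrable setT (fun x => (F i x)%:E)) ->
  m.-integrable setT (fun x => (\sum_(i <- s | Q i) F i x)%:E) /\
  \int[m]_x (\sum_(i <- s | Q i) F i x) = \sum_(i <- s | Q i) \int[m]_x F i x.
Proof.
move=> iF; elim: s => [|i s [IH1 IH2]].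
  under eq_fun do rewrite big_nil; under eq_Rintegral do rewrite big_nil.
  rewrite big_nil; split; first exact: integrable0.
  by rewrite /Rintegral integral0.
under eq_fun do rewrite big_cons; under eq_Rintegral do rewrite big_cons.
rewrite big_cons; case: (Q i) => //=; split; last by have iFi := iF i; rewrite RintegralD// IH2.
by under eq_fun do rewrite EFinD; exact: integrableD.
Qed.

Variable X : nat -> T -> S.
Hypothesis mX : forall i, measurable_fun setT (X i).
Hypothesis iX : forall i j k l, uniq [:: i; j; k; l] ->
  independent4 P mu (X i) (X j) (X k) (X l).

Variables (phi : S * S -> R) (M : R).
Hypothesis mphi : measurable_fun setT phi.
Hypothesis phiM : forall z, `|phi z| <= M.
Hypothesis phiC : forall x y, phi (x, y) = phi (y, x).

Local Notation m := (pprod mu mu).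
Let theta := \int[m]_z phi z.
Let h x := \int[mu]_y phi (x, y).
Let psi z := phi z - theta.

Let iphi : m.-integrable setT (fun z => (phi z)%:E).
Proof. exact: integrable_bounded phiM. Qed.

Let cst_intble d' (T' : measurableType d') (m' : probability T' R) (c : R) :
  m'.-integrable setT (fun x => c%:E).
Proof. exact: finite_measure_integrable_cst. Qed.

Let mpsi : measurable_fun setT psi.
Proof. exact: measurable_funB. Qed.

Let psiM z : `|psi z| <= M + `|theta|.
Proof. by rewrite (le_trans (ler_normB _ _))// lerD2r. Qed.

Let psiC x y : psi (x, y) = psi (y, x).
Proof. by rewrite /psi phiC. Qed.

Let C1 := \int[mu]_x (h x ^+ 2).
Let C2 := \int[m]_z (phi z ^+ 2).

Let C1_ge0 : 0 <= C1. Proof. by apply: Rintegral_ge0 => *; exact: sqr_ge0. Qed.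
Let C2_ge0 : 0 <= C2. Proof. by apply: Rintegral_ge0 => *; exact: sqr_ge0. Qed.

Let psi0 : \int[m]_z psi z = 0.
Proof.
have -> : \int[m]_z psi z = theta - \int[m]_z theta.
  exact: (RintegralB measurableT iphi (cst_intble m theta)).
have E := Rintegral_probability_cst m theta.
by rewrite E subrr.
Qed.

(** Covariance of two summands of the centred statistic. *)
Let cov i j k l := \int[P]_w (psi (X i w, X j w) * psi (X k w, X l w)).

Let M2 := (M + `|theta|) * (M + `|theta|).

Let bound2 z1 z2 : `|psi z1 * psi z2| <= M2.
Proof. by rewrite normrM ler_pM. Qed.

Let cov_disjoint i j k l : uniq [:: i; j; k; l] -> cov i j k l = 0.
Proof.
move=> u.
pose F (z : (S * S) * (S * S)) := psi z.1 * psi z.2.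
have mF : measurable_fun setT F.
  apply: measurable_funM; first exact: (measurableT_comp mpsi measurable_fst).
  exact: (measurableT_comp mpsi measurable_snd).
rewrite /cov (Rintegral_joint_law (mX i) (mX j) (mX k) (mX l) (iX u) mF (fun z => bound2 _ _)) /F /=.
under eq_Rintegral => z _.
  rewrite RintegralZl//; last exact: integrable_bounded psiM.
  rewrite psi0 mulr0; over.
exact: Rintegral_probability_cst.
Qed.

Let mh : measurable_fun setT h.
Proof. exact: (measurable_Rintegral mu mphi). Qed.

Let hM x : `|h x| <= M.
Proof.
have ix : mu.-integrable setT (fun y => (phi (x, y))%:E).
  apply: (@integrable_bounded _ _ _ _ _ (M)) => //.
  exact: (measurableT_comp mphi (measurable_pair1 x)).
rewrite (le_trans (le_normr_Rintegral measurableT ix))//.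
have iM := cst_intble mu M.
rewrite -[leRHS](Rintegral_probability_cst mu); apply: le_Rintegral => //.
exact: integrable_norm ix.
Qed.

Let theta_h : theta = \int[mu]_x h x.
Proof. exact: Rintegral_pprod phiM. Qed.

(** Given X i, the two factors are independent with the same conditional mean, so
    this covariance is the variance of the projection h. The index l is a dummy that
    brings the triple under a joint law of two pairs. *)
Let cov_share i j k : uniq [:: i; j; k] -> cov i j i k <= C1.
Proof.
move=> u; pose l := (maxn i (maxn j k)).+1.
have u4 : uniq [:: i; j; k; l].
  move: u; rewrite /= !inE !andbT !negb_or => /andP[/andP[-> ->] ->] /=.
  rewrite /l; apply/and3P; split; apply/eqP => E; have := leq_maxl i (maxn j k);
    have := leq_maxr i (maxn j k); have := leq_maxl j k; have := leq_maxr j k; lia.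
pose F (z : (S * S) * (S * S)) := psi z.1 * psi (z.1.1, z.2.1).
have mF : measurable_fun setT F.
  apply: measurable_funM; first exact: (measurableT_comp mpsi measurable_fst).
  apply: (measurableT_comp mpsi); apply: measurable_fun_pair.
    exact: (measurableT_comp measurable_fst measurable_fst).
  exact: (measurableT_comp measurable_fst measurable_snd).
rewrite /cov (Rintegral_joint_law (mX i) (mX j) (mX k) (mX l) (iX u4) mF (fun z => bound2 _ _)) /F /=.
pose h' x := h x - theta.
have E1 u0 : \int[m]_v F (u0, v) = psi u0 * h' u0.1.
  have mp : measurable_fun setT (fun v : S * S => psi (u0.1, v.1)).
    by apply: (measurableT_comp mpsi); apply: measurable_fun_pair => //.
  have ip : m.-integrable setT (fun v => (psi (u0.1, v.1))%:E).
    exact: (@integrable_bounded _ _ _ m (fun v => psi (u0.1, v.1)) _ mp (fun v => psiM _)).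
  rewrite /F/= RintegralZl//; congr (_ * _).
  rewrite (Rintegral_pprod _ _ mp (fun v => psiM _))/=.
  under eq_Rintegral do rewrite Rintegral_probability_cst.
  have i5 := cst_intble mu theta.
  rewrite /psi RintegralB ?Rintegral_probability_cst//.
  apply: (@integrable_bounded _ _ _ _ _ (M)) => //.
  exact: (measurableT_comp mphi (measurable_pair1 u0.1)).
under eq_Rintegral do rewrite E1.
have mh' : measurable_fun setT h' by exact: measurable_funB.
have h'M x : `|h' x| <= M + `|theta| by rewrite (le_trans (ler_normB _ _))// lerD2r.
rewrite (@Rintegral_pprod _ _ _ _ _ _ _ _ M2); last 2 first.
- by apply: measurable_funM => //; exact: (measurableT_comp mh' measurable_fst).
- by move=> z; rewrite normrM ler_pM.
have E2 x : \int[mu]_y (psi (x, y) * h' (x, y).1) = h' x ^+ 2.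
  have ix : mu.-integrable setT (fun y => (phi (x, y))%:E).
    apply: (@integrable_bounded _ _ _ _ _ (M)) => //.
    exact: (measurableT_comp mphi (measurable_pair1 x)).
  rewrite /= RintegralZr//; last first.
    apply: (@integrable_bounded _ _ _ _ _ (M + `|theta|)) => //.
    exact: (measurableT_comp mpsi (measurable_pair1 x)).
  have i5 := cst_intble mu theta.
  by rewrite /psi RintegralB// Rintegral_probability_cst expr2.
under eq_Rintegral do rewrite E2.
have ih : mu.-integrable setT (fun x => (h x)%:E) by exact: integrable_bounded hM.
have ih2 : mu.-integrable setT (fun x => (h x ^+ 2)%:E).
  apply: (@integrable_bounded _ _ _ _ _ (M * M)); first exact: measurable_funX.
  by move=> x; rewrite normrX expr2 ler_pM.
have i2 : mu.-integrable setT (fun x => (2 * theta * h x)%:E).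
  by under eq_fun do rewrite EFinM; exact: integrableZl.
have i3 : mu.-integrable setT (fun x => (h x ^+ 2 - 2 * theta * h x)%:E).
  by under eq_fun do rewrite EFinB; exact: integrableB.
have E3 x : h' x ^+ 2 = h x ^+ 2 - 2 * theta * h x + theta ^+ 2 by rewrite /h'; ring.
under eq_Rintegral do rewrite E3.
have i4 := cst_intble mu (theta ^+ 2).
rewrite RintegralD// RintegralB// RintegralZl// -theta_h Rintegral_probability_cst -/C1.
have := sqr_ge0 theta; nra.
Qed.

Let cov_diag i j : i != j -> cov i j i j <= C2.
Proof.
move=> ij; pose k := (maxn i j).+1; pose l := (maxn i j).+2.
have u4 : uniq [:: i; j; k; l].
  rewrite /= !inE !andbT !negb_or ij /k /l /=.
  by rewrite -!andbA; apply/and5P; split; apply/eqP => E; have := leq_maxl i j;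
    have := leq_maxr i j; lia.
pose F (z : (S * S) * (S * S)) := psi z.1 * psi z.1.
have mF : measurable_fun setT F.
  by apply: measurable_funM; exact: (measurableT_comp mpsi measurable_fst).
have -> : cov i j i j = \int[P]_w F ((X i w, X j w), (X k w, X l w)) by [].
rewrite (Rintegral_joint_law (mX i) (mX j) (mX k) (mX l) (iX u4) mF (fun z => bound2 _ _)) /F /=.
under eq_Rintegral do rewrite Rintegral_probability_cst.
have i1 : m.-integrable setT (fun x => (phi x ^+ 2)%:E).
  apply: (@integrable_bounded _ _ _ _ _ (M * M)); first exact: measurable_funX.
  by move=> x; rewrite normrX expr2 ler_pM.
have i2 : m.-integrable setT (fun x => (2 * theta * phi x)%:E).
  by under eq_fun do rewrite EFinM; exact: integrableZl.
have i3 : m.-integrable setT (fun x => (phi x ^+ 2 - 2 * theta * phi x)%:E).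
  by under eq_fun do rewrite EFinB; exact: integrableB.
have E3 x : psi x * psi x = phi x ^+ 2 - 2 * theta * phi x + theta ^+ 2 by rewrite /psi; ring.
under eq_Rintegral do rewrite E3.
have i4 := cst_intble m (theta ^+ 2).
rewrite RintegralD// RintegralB// RintegralZl// -/theta Rintegral_probability_cst -/C2.
have := sqr_ge0 theta; nra.
Qed.

(** All coincidence patterns of two off-diagonal pairs at once. The counts on the
    right overestimate, but each sums in closed form over all pairs (k, l). *)
Let cov_le i j k l : i != j -> k != l ->
  cov i j k l <= C1 * ((i == k) + (i == l) + (j == k) + (j == l))%N%:R +
                 C2 * (((k == i) && (l == j)) + ((k == j) && (l == i)))%N%:R.
Proof.
move=> ij kl.
have sym1 a b c e : cov a b c e = cov b a c e.
  by apply: eq_Rintegral => w _; rewrite psiC.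
have sym2 a b c e : cov a b c e = cov a b e c.
  by apply: eq_Rintegral => w _; rewrite [psi (X c w, _)]psiC.
have K1 c (a e : nat) : c <= C1 -> (0 < a)%N -> c <= C1 * a%:R + C2 * e%:R.
  move=> cC a0; have a1 : 1 <= a%:R :> R by rewrite ler1n.
  have e0 : 0 <= e%:R :> R by [].
  have := mulr_ge0 C2_ge0 e0; have := ler_wpM2l C1_ge0 a1; lra.
have K2 c (a e : nat) : c <= C2 -> (0 < e)%N -> c <= C1 * a%:R + C2 * e%:R.
  move=> cC e0; have e1 : 1 <= e%:R :> R by rewrite ler1n.
  have a0 : 0 <= a%:R :> R by [].
  have := mulr_ge0 C1_ge0 a0; have := ler_wpM2l C2_ge0 e1; lra.
have [ik|ik] := eqVneq i k.
  subst k; have [jl|jl] := eqVneq j l.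
    by subst l; apply: K2; [exact: cov_diag|rewrite !addn_gt0 ?orbT].
  by apply: K1; [apply: cov_share; rewrite /= !inE negb_or ij kl jl|rewrite !addn_gt0 ?orbT].
have [il|il] := eqVneq i l.
  subst l; have [jk|jk] := eqVneq j k.
    by subst k; apply: K2; [rewrite sym2; exact: cov_diag|rewrite !addn_gt0 ?orbT].
  by apply: K1; [rewrite sym2; apply: cov_share; rewrite /= !inE negb_or ij ik jk|rewrite !addn_gt0 ?orbT].
have [jk|jk] := eqVneq j k.
  subst k; apply: K1; last by rewrite !addn_gt0 ?orbT.
  by rewrite sym1; apply: cov_share; rewrite /= !inE negb_or eq_sym ij kl il.
have [jl|jl] := eqVneq j l.
  subst l; apply: K1; last by rewrite !addn_gt0 ?orbT.
  by rewrite sym1 sym2; apply: cov_share; rewrite /= !inE negb_or eq_sym ij jk ik.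
rewrite cov_disjoint; first by rewrite addr_ge0// mulr_ge0.
by rewrite /= !inE !negb_or ij ik il jk jl kl.
Qed.

Let sum_pair_eq1 n (i : 'I_n) :
  (\sum_(q : 'I_n * 'I_n) (i == q.1 :> nat) = n)%N.
Proof.
rewrite -(pair_bigA _ (fun k l : 'I_n => (i == k :> nat) : nat))/=.
under eq_bigr do rewrite sum_nat_const card_ord.
rewrite (bigD1 i)//= eqxx muln1 big1 ?addn0// => k /negbTE ki.
by rewrite (_ : (i == k :> nat) = false) ?muln0// eq_sym.
Qed.

Let sum_pair_eq2 n (i : 'I_n) :
  (\sum_(q : 'I_n * 'I_n) (i == q.2 :> nat) = n)%N.
Proof.
rewrite -(pair_bigA _ (fun k l : 'I_n => (i == l :> nat) : nat))/= exchange_big/=.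
under eq_bigr do rewrite sum_nat_const card_ord.
rewrite (bigD1 i)//= eqxx muln1 big1 ?addn0// => k /negbTE ki.
by rewrite (_ : (i == k :> nat) = false) ?muln0// eq_sym.
Qed.

Let sum_pair_eq n (i j : 'I_n) :
  (\sum_(q : 'I_n * 'I_n) ((q.1 == i :> nat) && (q.2 == j :> nat)) = 1)%N.
Proof.
rewrite (bigD1 (i, j))//= !eqxx big1// => -[k l] hq.
by apply/eqP; rewrite eqb0; apply: contra hq => /andP[/eqP/val_inj/= -> /eqP/val_inj/= ->].
Qed.

Let card_offdiag n : #|[pred p : 'I_n * 'I_n | p.2 != p.1]| = (n * n.-1)%N.
Proof.
rewrite -sum1_card -(pair_big_dep xpredT (fun i j : 'I_n => j != i) (fun _ _ => 1%N))/=.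
under eq_bigr => i _.
  rewrite sum1_card (_ : #|_| = n.-1); last by rewrite -[in RHS](card_ord n) -(cardC1 i).
  over.
by rewrite sum_nat_const card_ord.
Qed.

(** A fixed pair can share one index with another pair in 4 ways, each realized by at
    most n pairs, and has the same two indices as 2 pairs. *)
Lemma ustatistic_second_moment (n : nat) :
  let U w := \sum_(i < n) \sum_(j < n | j != i) phi (X i w, X j w) in
  P.-integrable setT (fun w => ((U w - (n * n.-1)%:R * theta) ^+ 2)%:E) /\
  \int[P]_w ((U w - (n * n.-1)%:R * theta) ^+ 2) <=
    (n * n.-1)%:R * (4 * n%:R * C1 + 2 * C2).
Proof.
move=> U; pose I2 := ('I_n * 'I_n)%type; pose Q (p : I2) := p.2 != p.1.
pose a (p : I2) w := psi (X p.1 w, X p.2 w).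
have UE w : U w - (n * n.-1)%:R * theta = \sum_(p | Q p) a p w.
  rewrite /a /psi sumrB sumr_const -card_offdiag mulr_natl.
  by rewrite /U (pair_big_dep xpredT (fun i j : 'I_n => j != i)).
have ma p : measurable_fun setT (a p).
  by apply: (measurableT_comp mpsi); exact: measurable_fun_pair.
have iaa p q : P.-integrable setT (fun w => (a p w * a q w)%:E).
  apply: (@integrable_bounded _ _ _ _ _ M2); first exact: measurable_funM.
  by move=> w; exact: bound2.
have sq w : (U w - (n * n.-1)%:R * theta) ^+ 2 =
    \sum_(p | Q p) \sum_(q | Q q) a p w * a q w.
  by rewrite UE expr2 big_distrlr.
have iS p : P.-integrable setT (fun w => (\sum_(q | Q q) a p w * a q w)%:E).
  by have [] := Rintegral_sum (index_enum I2) Q (iaa p).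
under eq_fun do rewrite sq; under eq_Rintegral do rewrite sq.
have [iSS ->] := Rintegral_sum (index_enum I2) Q iS; split => //.
have -> : (n * n.-1)%:R * (4 * n%:R * C1 + 2 * C2) =
    \sum_(p | Q p) (4 * n%:R * C1 + 2 * C2).
  by rewrite sumr_const card_offdiag mulr_natl.
apply: ler_sum => p pQ.
have [_ ->] := Rintegral_sum (index_enum I2) Q (iaa p).
pose B (q : I2) := C1 * ((p.1 == q.1 :> nat) + (p.1 == q.2 :> nat) +
    (p.2 == q.1 :> nat) + (p.2 == q.2 :> nat))%N%:R +
  C2 * (((q.1 == p.1 :> nat) && (q.2 == p.2 :> nat)) +
        ((q.1 == p.2 :> nat) && (q.2 == p.1 :> nat)))%N%:R.
have B0 q : 0 <= B q by rewrite addr_ge0// mulr_ge0.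
apply: (@le_trans _ _ (\sum_(q | Q q) B q)).
  by apply: ler_sum => q qQ; apply: cov_le; rewrite eq_sym.
apply: (@le_trans _ _ (\sum_(q : I2) B q)).
  by rewrite [leLHS]big_mkcond ler_sum// => q _; case: ifP.
rewrite /B big_split/= -!mulr_sumr -!natr_sum !big_split/=.
rewrite !sum_pair_eq1 !sum_pair_eq2 !sum_pair_eq.
rewrite le_eqVlt; apply/orP; left; apply/eqP; rewrite !natrD; ring.
Qed.

End Ustatistic.

(** * Moments of the kernel under a bounded density *)

Section Density.
Context {R : realType}.
Local Notation lam := (@lebesgue_measure R).
Local Notation mR := (measurableTypeR R).
Variables (mu : probability mR R) (f : R -> R).
Hypothesis mf : measurable_fun setT (f : mR -> R).
Hypothesis f0 : forall x, 0 <= f x.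
Hypothesis fmu : forall A : set mR, measurable A ->
  mu A = (\int[lam]_(x in A) (f x)%:E)%E.

Lemma density_L1 : L1 f.
Proof.
apply/integrableP; split; first exact/measurable_EFinP.
under eq_integral do rewrite gee0_abs ?lee_fin//.
by rewrite -fmu// probability_setT ltry.
Qed.

(** The density is almost everywhere the Radon-Nikodym derivative, as both have the
    same integral over every measurable set. *)
Lemma Rintegral_density (v : R -> R) (M : R) : measurable_fun setT (v : mR -> R) ->
  (forall x, `|v x| <= M) -> \int[mu]_x v x = \int[lam]_x (f x * v x).
Proof.
move=> mv vM.
have iv : mu.-integrable setT (EFin \o v) by exact: (@integrable_bounded _ _ mR mu v M mv vM).
have dom : mu `<< lam.
  apply/null_content_dominatesP => A mA A0; rewrite fmu//.
  by apply: null_set_integral => //; apply/measurable_EFinP; exact: measurable_funTS.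
rewrite /Rintegral; congr fine.
under [RHS]eq_integral do rewrite mulrC EFinM.
rewrite -(Radon_Nikodym_change_of_variables dom measurableT iv).
have mRN : measurable_fun setT
    (Radon_Nikodym (charge_of_finite_measure mu) lam : mR -> \bar R).
  exact: measurable_int (Radon_Nikodym_integrable _).
apply: ae_eq_integral => //.
- by apply: emeasurable_funM => //; exact/measurable_EFinP.
- by apply: emeasurable_funM => //; exact/measurable_EFinP.
apply: ae_eqe_mul2l; rewrite Radon_NikodymE//=.
case: cid => /= h [h1 h2 h3].
apply: integral_ae_eq => //=; first exact/measurable_EFinP.
by move=> E _ mE; rewrite -h3//= fmu.
Qed.

Variable Mf : R.
Hypothesis fM : forall x, `|f x| <= Mf.

Lemma density_L2 : L2 f.
Proof.
split=> //; apply: (integrable_le (w := fun x : mR => Mf * `|f x|)).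
- exact: measurable_funX.
- under eq_fun do rewrite EFinM; apply: integrableZl => //; exact: L1_norm density_L1.
- by move=> x; rewrite normrX expr2 ler_wpM2r.
Qed.

Lemma Rintegral_density_le (v : R -> R) (M : R) : measurable_fun setT (v : mR -> R) ->
  (forall x, 0 <= v x <= M) -> L1 v -> \int[mu]_x v x <= Mf * \int[lam]_x v x.
Proof.
move=> mv vM iv; have vM' x : `|v x| <= M by have /andP[v0 ?] := vM x; rewrite ger0_norm.
rewrite (Rintegral_density mv vM') -RintegralZl//; apply: le_Rintegral => //.
- apply: (integrable_le (w := fun x : mR => Mf * `|v x|)).
  + exact: measurable_funM.
  + under eq_fun do rewrite EFinM; apply: integrableZl => //; exact: L1_norm iv.
  + by move=> x; rewrite normrM ler_wpM2r.
- by rewrite /comp; under eq_fun do rewrite EFinM; exact: integrableZl.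
- move=> x _; have /andP[v0 _] := vM x; rewrite ler_wpM2r//.
  by apply: le_trans (fM x); exact: ler_norm.
Qed.

Section KernelMoments.
Variables (L g ddf : R -> R) (b : R).
Hypotheses (l1L : L1 L) (l1g : L1 g) (l2g : L2 g) (l2ddf : L2 ddf).
Hypotheses (wL : weak_derive2 L g) (wf : weak_derive2 f ddf).
Hypothesis l2G : L2 (autocorrelation g).
Hypothesis b0 : 0 < b.

Local Notation G := (autocorrelation g).
Local Notation r := (roughness (corr b L ddf)).
Local Notation M := (roughness g).
Let phi (z : mR * mR) := G ((z.1 - z.2) / b).

Let bn0 : b != 0. Proof. by rewrite gt_eqF. Qed.

Let mG : measurable_fun setT (G : mR -> R). Proof. by case: l2G. Qed.

Lemma measurable_kernel : measurable_fun setT phi.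
Proof.
apply: (measurableT_comp mG); apply: measurable_funM => //.
by apply: measurable_funB; [exact: measurable_fst|exact: measurable_snd].
Qed.

Lemma kernel_bounded z : `|phi z| <= M.
Proof. exact: autocorrelation_bounded. Qed.

Lemma kernel_sym x y : phi (x, y) = phi (y, x).
Proof. by rewrite /phi/= -(autocorrelation_even l2g) -mulNr opprB. Qed.

Let mkernel1 x : measurable_fun setT (fun y : mR => phi (x, y)).
Proof. exact: (measurableT_comp measurable_kernel (measurable_pair1 x)). Qed.

Let l2f : L2 f := density_L2.

Let hE x : \int[mu]_y phi (x, y) = \int[lam]_y (G ((x - y) / b) * f y).
Proof.
rewrite (Rintegral_density (mkernel1 x) (fun y => kernel_bounded _)).
by apply: eq_Rintegral => y _; rewrite mulrC.
Qed.

Lemma roughness_corr_pilot : roughness (corr b g f) = b ^+ 4 * r.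
Proof.
rewrite -(roughness_corr_weak l1L l1g l2f l2ddf wL wf bn0).
rewrite roughnessZ; last exact: (corr_young b l1g l2f).1.
by rewrite mulrA -exprVn -exprM -exprMn mulfV// expr1n mul1r.
Qed.

Let mh : measurable_fun setT (fun x : mR => \int[mu]_y phi (x, y)).
Proof. exact: (measurable_Rintegral mu measurable_kernel). Qed.

Let hM x : `|\int[mu]_y phi (x, y)| <= M.
Proof.
have ix : mu.-integrable setT (fun y => (phi (x, y))%:E).
  exact: integrable_bounded (mkernel1 x) (fun y => kernel_bounded _).
have iM : mu.-integrable setT (fun=> M%:E).
  exact: finite_measure_integrable_cst.
rewrite (le_trans (le_normr_Rintegral measurableT ix))//.
rewrite -[leRHS](Rintegral_probability_cst mu); apply: le_Rintegral => //.
  exact: integrable_norm ix.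
by move=> y _; exact: kernel_bounded.
Qed.

(** The mean is b times the squared norm of [corr b g f], and moving the derivatives
    to f contributes a factor b^2 to that function. *)
Lemma kernel_mean : \int[pprod mu mu]_z phi z = b ^+ 5 * r.
Proof.
rewrite (Rintegral_pprod _ _ measurable_kernel kernel_bounded).
rewrite (Rintegral_density mh hM).
under eq_Rintegral do rewrite hE.
rewrite (Rintegral2_autocorrelation l1g l2g b0 l2f) roughness_corr_pilot.
by rewrite mulrA -exprS.
Qed.

(** The projection is a smoothing of [corr b g f], whose squared norm is already of
    order b^4. *)
Lemma kernel_projection_le :
  \int[mu]_x ((\int[mu]_y phi (x, y)) ^+ 2) <=
  Mf * (b ^+ 6 * (\int[lam]_t `|g t|) ^+ 2 * r).
Proof.
have Mf0 : 0 <= Mf by exact: le_trans (fM 0).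
have [ml2 il2] := L2_Rintegral_autocorrelation l1g l2g b0 l2f.
have l1h : L1 (fun x => (\int[mu]_y phi (x, y)) ^+ 2).
  by rewrite /L1 /comp; under eq_fun do rewrite hE.
have hM2 x : 0 <= (\int[mu]_y phi (x, y)) ^+ 2 <= M ^+ 2.
  rewrite sqr_ge0/= -[leLHS]real_normK ?num_real// lerXn2r ?nnegrE ?roughness_ge0//.
have mh2 : measurable_fun setT (fun x : mR => (\int[mu]_y phi (x, y)) ^+ 2).
  exact: measurable_funX.
apply: (le_trans (Rintegral_density_le mh2 hM2 l1h)).
apply: ler_wpM2l => //.
under eq_Rintegral do rewrite hE.
apply: (le_trans (roughness_Rintegral_autocorrelation l1g l2g b0 l2f)).
rewrite roughness_corr_pilot le_eqVlt; apply/orP; left; apply/eqP; ring.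
Qed.

(** For each x the inner integral is taken against f, which is bounded, and a change of
    variables gives the factor b. *)
Lemma kernel_second_moment_le :
  \int[pprod mu mu]_z (phi z ^+ 2) <= Mf * (b * roughness G).
Proof.
have Mf0 : 0 <= Mf by exact: le_trans (fM 0).
have m2 : measurable_fun setT (fun z => phi z ^+ 2).
  by apply: measurable_funX; exact: measurable_kernel.
have M2 z : 0 <= phi z ^+ 2 <= M ^+ 2.
  rewrite sqr_ge0/= -[leLHS]real_normK ?num_real// lerXn2r ?nnegrE ?roughness_ge0//.
  exact: kernel_bounded.
have M2' z : `|phi z ^+ 2| <= M ^+ 2 by have /andP[? ?] := M2 z; rewrite ger0_norm.
rewrite (Rintegral_pprod _ _ m2 M2').
rewrite -[leRHS](Rintegral_probability_cst mu).
have inner x : \int[mu]_y (phi (x, y) ^+ 2) <= Mf * (b * roughness G).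
  have mx : measurable_fun setT (fun y : mR => phi (x, y) ^+ 2).
    exact: measurable_funX.
  have [_ iG2] := l2G.
  have nb : - b^-1 != 0 by rewrite oppr_eq0 invr_eq0.
  have E y : phi (x, y) ^+ 2 = G (x / b + (- b^-1) * y) ^+ 2.
    by rewrite /phi/=; congr (G _ ^+ 2); field.
  have l1x : L1 (fun y => phi (x, y) ^+ 2).
    rewrite /L1 /comp; under eq_fun do rewrite E.
    exact: (integrable_affine (x / b) nb iG2).
  apply: (le_trans (Rintegral_density_le mx (fun y => M2 _) l1x)).
  apply: ler_wpM2l => //.
  under eq_Rintegral do rewrite E.
  rewrite (Rintegral_affine (x / b) nb iG2) normrN normfV invrK gtr0_norm//.
have iM : mu.-integrable setT (fun=> (Mf * (b * roughness G))%:E).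
  exact: finite_measure_integrable_cst.
apply: le_Rintegral => //.
apply: (@integrable_bounded _ _ _ _ _ (Mf * (b * roughness G))).
  exact: (measurable_Rintegral mu m2).
move=> x; rewrite ger0_norm//; apply: Rintegral_ge0 => y _; exact: sqr_ge0.
Qed.

End KernelMoments.
End Density.

(** * Convergence in probability *)

Section ConvergenceInProbability.
Context d (T : measurableType d) (R : realType) (P : probability T R).
Implicit Types (Y Z : nat -> T -> R).

(** Chebyshev's inequality. *)
Lemma cvg_in_probability_L2 Y (c : R) : (forall n, measurable_fun setT (Y n)) ->
  (forall n, P.-integrable setT (fun w => ((Y n w - c) ^+ 2)%:E)) ->
  (fun n => \int[P]_w ((Y n w - c) ^+ 2)) @ \oo --> 0 -> cvg_in_probability P Y c.
Proof.
move=> mY iY Y0; split => // e e0.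
pose A n := [set w | e < `|Y n w - c|].
have mA n : measurable (A n).
  rewrite -[X in measurable X]setTI.
  have mn : measurable_fun setT (fun w => `|Y n w - c|).
    by apply: measurableT_comp => //; exact: measurable_funB.
  rewrite (_ : A n = (fun w => `|Y n w - c|) @^-1` `]e, +oo[%classic); first exact: mn.
  by apply/seteqP; split => w /=; rewrite in_itv/= andbT.
have PA n : (P (A n) <= ((e ^+ 2)^-1 * \int[P]_w ((Y n w - c) ^+ 2))%:E)%E.
  have e2 : 0 < e ^+ 2 by rewrite exprn_gt0.
  have Pf : P (A n) \is a fin_num by rewrite fin_num_measure.
  rewrite -(fineK Pf) lee_fin ler_pdivlMl//.
  have -> : e ^+ 2 * fine (P (A n)) = \int[P]_w (e ^+ 2 * \1_(A n) w).
    rewrite RintegralZl//; last exact: integrable_indic.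
    by congr (_ * _); rewrite /Rintegral integral_indic// setIT.
  apply: le_Rintegral => //.
    rewrite /comp; under eq_fun do rewrite EFinM; apply: integrableZl => //.
    exact: integrable_indic.
  exact: iY.
  move=> w _; rewrite indicE; have [|] := boolP (w \in A n).
    rewrite inE /A/= mulr1 => /ltW h; rewrite -[leRHS]real_normK ?num_real//.
    by rewrite lerXn2r ?nnegrE// ltW.
  by rewrite mulr0 sqr_ge0.
apply: (@squeeze_cvge _ _ _ _ (cst 0%E) _
  (fun n => ((e ^+ 2)^-1 * \int[P]_w ((Y n w - c) ^+ 2))%:E)).
- by apply: nearW => n; rewrite measure_ge0/=; exact: PA.
- exact: cvg_cst.
- apply: cvg_EFin; first exact: nearW.
  rewrite -[X in _ --> X](mulr0 (e ^+ 2)^-1); apply: cvgM => //; exact: cvg_cst.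
Qed.

(** The continuous mapping theorem in the form of an inclusion of events, with maps
    that may depend on n. *)
Lemma cvg_in_probability_map Y Z (c c' : R) : cvg_in_probability P Y c ->
  (forall n, measurable_fun setT (Z n)) ->
  (forall e, 0 < e -> exists2 de, 0 < de &
    \forall n \near \oo, forall w, `|Y n w - c| <= de -> `|Z n w - c'| <= e) ->
  cvg_in_probability P Z c'.
Proof.
move=> [mY cY] mZ YZ; split => // e e0.
have [de de0 near] := YZ e e0.
have mA (W : nat -> T -> R) (a : R) x n : measurable_fun setT (W n) ->
    measurable [set w | x < `|W n w - a|].
  move=> mW; rewrite -[X in measurable X]setTI.
  have mn : measurable_fun setT (fun w => `|W n w - a|).
    by apply: measurableT_comp => //; exact: measurable_funB.
  rewrite (_ : [set w | _] = (fun w => `|W n w - a|) @^-1` `]x, +oo[%classic); first exact: mn.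
  by apply/seteqP; split => w /=; rewrite in_itv/= andbT.
apply: (@squeeze_cvge _ _ _ _ (cst 0%E) _ (fun n => P [set w | de < `|Y n w - c|])).
- apply: filterS near => n h; rewrite measure_ge0/=.
  apply: le_measure; rewrite ?inE; [exact: mA|exact: mA|].
  move=> w /= Zw; rewrite ltNge; apply/negP => /h.
  by rewrite leNgt Zw.
- exact: cvg_cst.
- exact: cY.
Qed.

End ConvergenceInProbability.

(** * Consistency of the pilot estimator *)

Section PilotConsistency.
Context d (T : measurableType d) (R : realType) (P : probability T R).
Local Notation lam := (@lebesgue_measure R).
Local Notation mR := (measurableTypeR R).
Variables (X : nat -> {RV P >-> R}) (f ddf L g : R -> R) (b : nat -> R).
Hypotheses (X_indep : mutually_independent X).
Hypothesis (X_density : forall i, has_density (X i) f).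

(** The sigma-algebra carried by the codomain of a random variable and the one of
    [measurableTypeR] are the same only up to conversion; this fixes the second. *)
Lemma measurable_RV i : measurable_fun setT (X i : T -> mR).
Proof. exact: (measurable_funPT (X i)). Qed.

Definition common_law : probability mR R :=
  distribution P (MeasurableFun.Pack (MeasurableFun.Class
    (isMeasurableFun.Build _ _ _ _ _ (measurable_RV 0)))).

Lemma law_density (A : set mR) : measurable A ->
  common_law A = (\int[lam]_(x in A) (f x)%:E)%E.
Proof. by move=> mA; case: (X_density 0) => _ _; apply. Qed.

Lemma law_RV i (A : set mR) : measurable A -> P (X i @^-1` A) = common_law A.
Proof.
by move=> mA; rewrite law_density//; case: (X_density i) => _ _ /(_ A mA).
Qed.

Lemma RV_independent4 i j k l : uniq [:: i; j; k; l] ->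
  independent4 P common_law (X i : T -> mR) (X j) (X k) (X l).
Proof.
move=> u A1 A2 A3 A4 m1 m2 m3 m4.
pose A n : set R := nth setT [:: A1; A2; A3; A4] (index n [:: i; j; k; l]).
have mA n : measurable (A n).
  by rewrite /A; case: (index n _) => [|[|[|[|m]]]] //=; rewrite nth_nil.
pose J := [fset n in [:: i; j; k; l]]%fset.
have pJ : perm_eq J [:: i; j; k; l].
  by apply: uniq_perm => // n; rewrite in_fset.
have := X_indep (J := J) (fun n _ => mA n).
rewrite bigcap_fset (perm_big _ pJ)/= (perm_big _ pJ)/= !big_cons !big_nil.
move: u; rewrite /= !inE !negb_or !andbT.
move=> /and3P[/and3P[ij ik il] /andP[jk jl] kl].
rewrite /A /= !eqxx (negbTE ij) (negbTE ik) (negbTE il) (negbTE jk) (negbTE jl) (negbTE kl)/=.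
rewrite setIT mule1 setIA muleA => E.
have Hx : forall n B, measurable B -> P (X n @^-1` B) = common_law B by exact: law_RV.
by rewrite -(Hx i _ m1) -(Hx j _ m2) -(Hx k _ m3) -(Hx l _ m4) -E.
Qed.

Variable Mf : R.
Hypothesis fM : forall x, `|f x| <= Mf.
Hypotheses (l1L : L1 L) (L_int : \int[lam]_u L u = 1) (l1g : L1 g) (l2g : L2 g) (l2ddf : L2 ddf).
Hypotheses (wL : weak_derive2 L g) (wf : weak_derive2 f ddf).
Hypothesis l2G : L2 (autocorrelation g).
Hypothesis b_pos : forall n, 0 < b n.
Hypothesis b_cvg0 : b @ \oo --> 0.
Hypothesis nb4 : (fun n => n%:R * b n ^+ 4) @ \oo --> +oo.
Hypothesis n2b9 : (fun n => n%:R ^+ 2 * b n ^+ 9) @ \oo --> +oo.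

Local Notation G := (autocorrelation g).
Let r n := roughness (corr (b n) L ddf).
Let gamma := \int[lam]_t `|g t|.

Lemma smoothed_roughness_cvg : r @ \oo --> roughness ddf.
Proof.
apply: roughness_cvg => //; first by move=> n; exact: (corr_young (b n) l1L l2ddf).1.
have := corr_approx_identity l1L l2ddf b_cvg0; rewrite L_int.
by under eq_fun do under eq_fun do rewrite mul1r.
Qed.

Let mf : measurable_fun setT (f : mR -> R). Proof. by case: (X_density 0). Qed.
Let f0 x : 0 <= f x. Proof. by case: (X_density 0). Qed.

Let U n w := \sum_(i < n) \sum_(j < n | j != i) G ((X i w - X j w) / b n).

Lemma RU_second_moment n :
  P.-integrable setT (fun w => ((U n w - (n * n.-1)%:R * (b n ^+ 5 * r n)) ^+ 2)%:E) /\
  \int[P]_w ((U n w - (n * n.-1)%:R * (b n ^+ 5 * r n)) ^+ 2) <=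
  (n * n.-1)%:R * (4 * n%:R * (Mf * (b n ^+ 6 * gamma ^+ 2 * r n)) +
                   2 * (Mf * (b n * roughness G))).
Proof.
have mk := measurable_kernel (b n) l2G.
have kb := kernel_bounded (b n) l2g.
have ks := kernel_sym (b n) l2g.
have [i1 i2] := @ustatistic_second_moment _ T R P _ mR common_law (fun i => X i : T -> mR)
  measurable_RV RV_independent4 _ _ mk kb ks n.
have tE := kernel_mean mf f0 law_density fM l1L l1g l2g l2ddf wL wf l2G (b_pos n).
split; first by move: i1; rewrite tE.
move: i2; rewrite /= tE => /le_trans; apply.
apply: ler_wpM2l => //; apply: lerD.
  apply: ler_wpM2l; first by rewrite mulr_ge0.
  exact: (kernel_projection_le mf f0 law_density fM l1L l1g l2g l2ddf wL wf l2G (b_pos n)).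
apply: ler_wpM2l => //.
exact: (kernel_second_moment_le mf law_density fM l2g l2G (b_pos n)).
Qed.

Lemma measurable_RU n : measurable_fun setT (RU g X b n).
Proof.
apply: measurable_funM => //; apply: measurable_sum => i.
rewrite (_ : (fun w => _) = (fun w => \sum_(j <- index_enum 'I_n) if j != i then
    G ((X i w - X j w) / b n) else 0)); last first.
  by apply/funext => w; rewrite big_mkcond.
apply: measurable_sum => j; case: (j != i) => //.
have mG : measurable_fun setT (G : mR -> R) by case: l2G.
apply: (measurableT_comp mG); apply: measurable_funM => //.
by apply: measurable_funB; exact: measurable_RV.
Qed.

(** Division by 0 makes the identity fail for n <= 1. *)
Lemma RU_split n w : (1 < n)%N -> RU g X b n w - roughness ddf =
  ((n * n.-1)%:R * b n ^+ 5)^-1 * (U n w - (n * n.-1)%:R * (b n ^+ 5 * r n)) +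
  (r n - roughness ddf).
Proof.
move=> n1; have n0 : (0 < n)%N by exact: ltn_trans n1.
have nn : n%:R - 1 = n.-1%:R :> R by rewrite -[in LHS](prednK n0) -natr1 addrK.
rewrite /RU nn natrM -/(U n w).
have a0 : n%:R != 0 :> R by rewrite pnatr_eq0 -lt0n.
have a1 : n.-1%:R != 0 :> R by rewrite pnatr_eq0 -lt0n -ltnS prednK.
have a2 : b n != 0 by rewrite gt_eqF.
by field; rewrite a0 a1 a2.
Qed.

Lemma RU_mean_square_cvg : (fun n => \int[P]_w ((RU g X b n w - roughness ddf) ^+ 2)) @ \oo --> 0.
Proof.
have Mf0 : 0 <= Mf by exact: le_trans (fM 0).
have r0 n : 0 <= r n by exact: roughness_ge0.
(* Chosen from the splitting into a stochastic and a deterministic error, with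
   (x + y)^2 <= 2 x^2 + 2 y^2 and 1 / (n - 1) <= 2 / n. *)
pose Bd n := 16 * (Mf * gamma ^+ 2) * r n * (n%:R * b n ^+ 4)^-1 +
   8 * (Mf * roughness G) * (n%:R ^+ 2 * b n ^+ 9)^-1 + 2 * (r n - roughness ddf) ^+ 2.
have v4 : (fun n => (n%:R * b n ^+ 4)^-1) @ \oo --> 0.
  apply/gtr0_cvgV0 => //; near=> n; rewrite mulr_gt0 ?exprn_gt0// ltr0n.
  by near: n; exact: nbhs_infty_gt.
have v9 : (fun n => (n%:R ^+ 2 * b n ^+ 9)^-1) @ \oo --> 0.
  apply/gtr0_cvgV0 => //; near=> n; rewrite mulr_gt0 ?exprn_gt0// ltr0n.
  by near: n; exact: nbhs_infty_gt.
have rc := smoothed_roughness_cvg.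
have Bd0 : Bd @ \oo --> 0.
  rewrite -[X in _ --> X](_ : 16 * (Mf * gamma ^+ 2) * roughness ddf * 0 +
    8 * (Mf * roughness G) * 0 + 2 * ((roughness ddf - roughness ddf) * (roughness ddf - roughness ddf)) = 0); last ring.
  have rd : (fun n => r n - roughness ddf) @ \oo --> roughness ddf - roughness ddf.
    by apply: cvgB => //; exact: cvg_cst.
  apply: cvgD; [apply: cvgD|].
  - by apply: cvgM => //; apply: cvgM => //; exact: cvg_cst.
  - by apply: cvgM => //; exact: cvg_cst.
  - by apply: cvgM; [exact: cvg_cst|under eq_fun do rewrite expr2; exact: cvgM].
apply: (@squeeze_cvgr _ _ _ _ (cst 0) Bd) => //; last exact: cvg_cst.
near=> n; have n1 : (1 < n)%N by near: n; exact: nbhs_infty_gt.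
rewrite Rintegral_ge0/=; last by move=> *; exact: sqr_ge0.
have [iZ leZ] := RU_second_moment n.
set Z := fun w => U n w - (n * n.-1)%:R * (b n ^+ 5 * r n) in iZ leZ.
set N := (n * n.-1)%:R : R in iZ leZ Z *.
have n0 : (0 < n)%N by exact: ltn_trans n1.
have nR : 0 < n%:R :> R by rewrite ltr0n.
have n1R : 2^-1 * n%:R <= n.-1%:R :> R.
  rewrite ler_pdivrMl// -natrM ler_nat; lia.
have N0 : 0 < N by rewrite ltr0n muln_gt0 n0 -ltnS prednK.
have NE : N = n%:R * n.-1%:R by rewrite /N natrM.
have bn := b_pos n.
pose al := (N * b n ^+ 5)^-1.
have al0 : 0 <= al by rewrite invr_ge0 mulr_ge0 ?exprn_ge0 ?ltW.
pose de := r n - roughness ddf.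
have i2 : P.-integrable setT (fun w => (2 * al ^+ 2 * Z w ^+ 2)%:E).
  by under eq_fun do rewrite EFinM; exact: integrableZl.
have i3 : P.-integrable setT (fun w => (2 * de ^+ 2)%:E).
  exact: finite_measure_integrable_cst.
have mRU : measurable_fun setT (fun w => (RU g X b n w - roughness ddf) ^+ 2).
  by apply: measurable_funX; apply: measurable_funB => //; exact: measurable_RU.
have pw w : (RU g X b n w - roughness ddf) ^+ 2 <= 2 * al ^+ 2 * Z w ^+ 2 + 2 * de ^+ 2.
  rewrite RU_split// -/N -/al -/(Z w) -/de.
  have := sqr_ge0 (al * Z w - de); nra.
have i4 : P.-integrable setT (fun w => (2 * al ^+ 2 * Z w ^+ 2 + 2 * de ^+ 2)%:E).
  by under eq_fun do rewrite EFinD; exact: integrableD.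
have i1 : P.-integrable setT (fun w => ((RU g X b n w - roughness ddf) ^+ 2)%:E).
  by apply: (integrable_le mRU i4) => w; rewrite ger0_norm ?sqr_ge0.
apply: (@le_trans _ _ (\int[P]_w (2 * al ^+ 2 * Z w ^+ 2 + 2 * de ^+ 2))).
  exact: le_Rintegral.
have Ec := Rintegral_probability_cst P (2 * de ^+ 2).
rewrite RintegralD// Ec RintegralZl//.
rewrite /Bd -/de lerD2r.
have al2 : 0 <= 2 * al ^+ 2 by rewrite mulr_ge0// sqr_ge0.
apply: (le_trans (ler_wpM2l al2 leZ)).
have bne : b n != 0 by rewrite gt_eqF.
have mne : n.-1%:R != 0 :> R by rewrite pnatr_eq0 -lt0n -ltnS prednK.
have nne : n%:R != 0 :> R by rewrite gt_eqF.
have m0 : 0 < n.-1%:R :> R by rewrite lt0r mne ler0n.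
have mi : (n.-1%:R)^-1 <= 2 * (n%:R)^-1 :> R.
  by rewrite -[2]invrK -invfM lef_pV2 ?posrE// mulr_gt0// invr_gt0.
have -> : 2 * al ^+ 2 * (N * (4 * n%:R * (Mf * (b n ^+ 6 * gamma ^+ 2 * r n)) +
    2 * (Mf * (b n * roughness G)))) =
  8 * (Mf * gamma ^+ 2) * r n * (b n ^+ 4)^-1 * (n.-1%:R)^-1 +
  4 * (Mf * roughness G) * (b n ^+ 9)^-1 * (n%:R)^-1 * (n.-1%:R)^-1.
  by rewrite /al NE; field; rewrite bne mne nne.
have gM : 0 <= Mf * gamma ^+ 2 by rewrite mulr_ge0// sqr_ge0.
have GM : 0 <= Mf * roughness G by rewrite mulr_ge0// roughness_ge0.
have c4 : 0 <= 8 * (Mf * gamma ^+ 2) * r n * (b n ^+ 4)^-1.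
  by apply: mulr_ge0; [apply: mulr_ge0 (r0 n); exact: mulr_ge0|rewrite invr_ge0 exprn_ge0 ?ltW].
have c9 : 0 <= 4 * (Mf * roughness G) * (b n ^+ 9)^-1 * (n%:R)^-1.
  rewrite mulr_ge0 ?invr_ge0 ?ler0n// mulr_ge0//; first by rewrite mulr_ge0.
  by rewrite invr_ge0 exprn_ge0 ?ltW.
apply: lerD; [move: (ler_wpM2l c4 mi)|move: (ler_wpM2l c9 mi)].
  by move=> /le_trans; apply; rewrite le_eqVlt; apply/orP; left; apply/eqP; field; rewrite bne nne.
by move=> /le_trans; apply; rewrite le_eqVlt; apply/orP; left; apply/eqP; field; rewrite bne nne.
Unshelve. all: by end_near. Qed.

Lemma integrable_RU_sqr_error n : P.-integrable setT (fun w => ((RU g X b n w - roughness ddf) ^+ 2)%:E).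
Proof.
pose M := `|(n%:R * (n%:R - 1) * b n ^+ 5)^-1| *
  (\sum_(i < n) \sum_(j < n | j != i) roughness g) + `|roughness ddf|.
apply: (@integrable_bounded _ _ _ _ _ (M ^+ 2)).
  by apply: measurable_funX; apply: measurable_funB => //; exact: measurable_RU.
move=> w; rewrite normrX lerXn2r ?nnegrE//.
  rewrite addr_ge0// mulr_ge0// sumr_ge0// => i _; rewrite sumr_ge0// => j _.
  exact: roughness_ge0.
rewrite (le_trans (ler_normB _ _))// lerD2r normrM ler_wpM2l//.
rewrite (le_trans (ler_norm_sum _ _ _))// ler_sum// => i _.
rewrite (le_trans (ler_norm_sum _ _ _))// ler_sum// => j _.
exact: autocorrelation_bounded.
Qed.

Lemma RU_consistent : cvg_in_probability P (RU g X b) (roughness ddf).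
Proof.
exact: (cvg_in_probability_L2 measurable_RU integrable_RU_sqr_error RU_mean_square_cvg).
Qed.

End PilotConsistency.

(** * AMISE and the plug-in bandwidth *)

Section Bandwidth.
Context {R : realType}.
Local Notation lam := (@lebesgue_measure R).

(** A function of zero squared norm vanishes almost everywhere and cannot have
    integral 1. *)
Lemma roughness_gt0 (K : R -> R) : L2 K -> \int[lam]_u K u = 1 -> 0 < roughness K.
Proof.
move=> [mK iK] K1; rewrite lt_neqAle roughness_ge0 andbT; apply/eqP => /esym K0.
suff : \int[lam]_u K u = 0 by rewrite K1 => /eqP; rewrite oner_eq0.
have K20 : (\int[lam]_u `|(K u ^+ 2)%:E| = 0)%E.
  under eq_integral do rewrite gee0_abs ?lee_fin ?sqr_ge0//.
  by rewrite -[LHS]fineK ?integrable_fin_num// -[X in X%:E]/(roughness K) K0.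
have m2 : measurable_fun setT (fun u : measurableTypeR R => (K u ^+ 2)%:E).
  by apply/measurable_EFinP; exact: measurable_funX.
have /(_ m2) [ae0 _] := @ae_eq_integral_abs _ _ _ lam setT measurableT (fun u => (K u ^+ 2)%:E).
rewrite /Rintegral (ae_eq_integral (cst 0%E))//; first by rewrite integral0.
  exact/measurable_EFinP.
apply: ae_impl (ae0 K20) => u h uT; have [] := h uT.
by move=> /eqP; rewrite expf_eq0/= => /eqP ->.
Qed.

(** With y the fifth root of x, y^5 - 1 is y - 1 times a factor that is at least 1. *)
Lemma powR_inv5_dist (x : R) : 0 <= x -> `|x `^ 5^-1 - 1| <= `|x - 1|.
Proof.
move=> x0; set y := x `^ 5^-1; have y0 : 0 <= y by exact: powR_ge0.
have -> : x = y ^+ 5.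
  by rewrite /y -powR_mulrn ?powR_ge0// -powRrM mulVf ?powRr1.
have -> : y ^+ 5 - 1 = (y - 1) * (1 + (y + y ^+ 2 + y ^+ 3 + y ^+ 4)) by ring.
rewrite normrM ler_peMr// ger0_norm.
  by rewrite lerDl !addr_ge0 ?exprn_ge0.
by rewrite !addr_ge0 ?exprn_ge0.
Qed.

Section Fixed.
Variables (K ddf : R -> R) (n : nat).
Hypotheses (K0 : 0 < roughness K) (mu20 : mu2 K != 0) (R0 : 0 < roughness ddf) (n0 : (0 < n)%N).

Let m0 : 0 < mu2 K ^+ 2. Proof. by rewrite exprn_even_gt0. Qed.
Let nR : 0 < n%:R :> R. Proof. by rewrite ltr0n. Qed.

Let base_gt0 (r : R) : 0 < r -> 0 < roughness K / (mu2 K ^+ 2 * r * n%:R).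
Proof. by move=> r0; rewrite divr_gt0// mulr_gt0// mulr_gt0. Qed.

Lemma bandwidth_gt0 (r : R) : 0 < r -> 0 < bandwidth K r n.
Proof. by move=> r0; apply: powR_gt0; exact: base_gt0. Qed.

Lemma bandwidth_ratio (r : R) : 0 < r ->
  bandwidth K r n / h_AMISE K ddf n = (roughness ddf / r) `^ 5^-1.
Proof.
move=> r0; rewrite /bandwidth (_ : roughness K / (mu2 K ^+ 2 * r * n%:R) =
  roughness K / (mu2 K ^+ 2 * roughness ddf * n%:R) *
  (roughness ddf / r)); last first.
  by field; rewrite mu20 !gt_eqF.
rewrite powRM; last 2 first.
- by rewrite ltW// base_gt0.
- by rewrite divr_ge0 ?ltW.
rewrite mulrAC mulfV ?mul1r// gt_eqF//; exact: bandwidth_gt0 R0.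
Qed.

(** The bias term scales by rho^4 and the variance term by 1 / rho, and at the optimum
    they are in ratio 1 : 4. *)
Lemma AMISE_ratio (rho : R) : 0 < rho ->
  AMISE K ddf n (rho * h_AMISE K ddf n) / AMISE K ddf n (h_AMISE K ddf n) =
  (rho ^+ 4 + 4 * rho^-1) / 5.
Proof.
move=> rho0; have h0 : 0 < h_AMISE K ddf n by exact: bandwidth_gt0 R0.
have h5 : h_AMISE K ddf n ^+ 5 = roughness K / (mu2 K ^+ 2 * roughness ddf * n%:R).
  rewrite /h_AMISE /bandwidth -powR_mulrn ?powR_ge0// -powRrM mulVf ?powRr1//.
  by rewrite ltW// base_gt0.
set h := h_AMISE K ddf n in h0 h5 *.
have KE : roughness K = h ^+ 5 * (mu2 K ^+ 2 * roughness ddf * n%:R).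
  by rewrite h5 divfK// gt_eqF// mulr_gt0// mulr_gt0.
rewrite /AMISE KE; field.
rewrite !gt_eqF ?mu20//=.
have h40 := exprn_gt0 4 h0.
have mr := mulr_gt0 m0 R0.
by rewrite -mulrA addr_gt0 ?(mulr_gt0 (mulr_gt0 h40 mr))// (mulr_gt0 h40 mr).
Qed.

End Fixed.

(** The polynomial identity exhibits the factor rho - 1; its cofactor is bounded
    because rho stays in [1/2, 3/2]. *)
Lemma AMISE_factor_dist (rho : R) (de : R) : de <= 2^-1 -> `|rho - 1| <= de ->
  `|(rho ^+ 4 + 4 * rho^-1) / 5 - 1| <= 4 * de.
Proof.
move=> de2 rd; have := rd; rewrite ler_norml => /andP[r1 r2].
have rho0 : 2^-1 <= rho by lra.
have rp : 0 < rho by lra.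
have -> : (rho ^+ 4 + 4 * rho^-1) / 5 - 1 =
    (rho - 1) * (((1 + rho) * (1 + rho ^+ 2) - 4 * rho^-1) / 5).
  by field; rewrite gt_eqF.
have ri : 0 <= rho^-1 <= 2.
  by rewrite invr_ge0 ltW//= -[leRHS]invrK lef_pV2 ?posrE.
rewrite normrM mulrC ler_pM//.
have /andP[ri0 ri2] := ri.
have q : 0 <= (1 + rho) * (1 + rho ^+ 2) <= 20.
  by apply/andP; split; nra.
have /andP[q0 q1] := q.
by rewrite ler_norml; apply/andP; split; lra.
Qed.

(** Inversion is discontinuous at 0; writing it as x times a real power of x^2 reduces
    it to known measurable functions. *)
Lemma measurable_invr : measurable_fun setT (fun x : R => x^-1).
Proof.
rewrite (_ : (fun x => x^-1) = fun x : R => x * (x ^+ 2) `^ (-1)).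
  apply: measurable_funM => //.
  exact: (measurableT_comp (measurable_powR (-1)) (exprn_measurable 2)).
apply/funext => x; rewrite powR_inv1 ?sqr_ge0//.
have [->|x0] := eqVneq x 0; first by rewrite invr0 mul0r.
by rewrite expr2 invfM mulrA mulfV// mul1r.
Qed.

End Bandwidth.

(** * Oracle equivalence *)

Section OracleEquivalence.
Context d (T : measurableType d) (R : realType) (P : probability T R).
Variables (X : nat -> {RV P >-> R}) (ddL K ddf : R -> R) (b tau : nat -> R).
Hypotheses (K0 : 0 < roughness K) (mu20 : mu2 K != 0) (R0 : 0 < roughness ddf).
Hypotheses (tau0 : tau @ \oo --> 0) (tau_pos : forall n, 0 < tau n).
Hypothesis cRU : cvg_in_probability P (RU ddL X b) (roughness ddf).

Lemma measurable_h_GCPI n : measurable_fun setT (h_GCPI K ddL X b tau n).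
Proof.
have [mRU _] := cRU.
apply: (measurableT_comp (measurable_powR _)).
apply: measurable_funM => //; apply: (measurableT_comp measurable_invr).
apply: measurable_funM => //; apply: measurable_funM => //.
by apply: measurable_maxr.
Qed.

Lemma h_GCPI_gt0 n w : (0 < n)%N -> 0 < h_GCPI K ddL X b tau n w.
Proof.
move=> n0; apply: (bandwidth_gt0 K0 mu20 n0).
by rewrite lt_max tau_pos orbT.
Qed.

Lemma h_GCPI_ratio_cvg :
  cvg_in_probability P (fun n w => h_GCPI K ddL X b tau n w / h_AMISE K ddf n) 1.
Proof.
apply: (cvg_in_probability_map cRU).
  by move=> n; apply: measurable_funM => //; exact: measurable_h_GCPI.
move=> e e0; set r0 := roughness ddf; have R0' : 0 < r0 := R0.
(* The first bound keeps the estimate above r0 / 2, hence above tau n for large n. *)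
pose de := Num.min (r0 / 2) (e * (r0 / 2)).
have r2 : 0 < r0 / 2 by rewrite divr_gt0.
exists de; first by rewrite lt_min r2 mulr_gt0.
near=> n => w; have n0 : (0 < n)%N by near: n; exact: nbhs_infty_gt.
have tn : tau n < r0 / 2.
  near: n; move/cvgrPdist_lt : tau0 => /(_ _ r2); apply: filterS => n.
  by rewrite sub0r normrN; apply: le_lt_trans; exact: ler_norm.
rewrite le_min => /andP[d1 d2].
have rU : r0 / 2 <= RU ddL X b n w by move: d1; rewrite ler_norml => /andP[]; lra.
have mE : Num.max (RU ddL X b n w) (tau n) = RU ddL X b n w.
  by apply/max_idPl; rewrite (le_trans (ltW tn)).
have rp : 0 < RU ddL X b n w by exact: lt_le_trans rU.
rewrite /h_GCPI mE (bandwidth_ratio K0 mu20 R0 n0 rp) -/r0.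
apply: (le_trans (powR_inv5_dist _)); first by rewrite divr_ge0// ltW.
have -> : r0 / RU ddL X b n w - 1 = (r0 - RU ddL X b n w) / RU ddL X b n w.
  by rewrite mulrBl mulfV// gt_eqF.
rewrite normrM normfV (gtr0_norm rp) ler_pdivrMr// distrC (le_trans d2)//.
by rewrite ler_wpM2l// ltW.
Unshelve. all: by end_near. Qed.

Lemma AMISE_ratio_cvg : cvg_in_probability P
  (fun n w => AMISE K ddf n (h_GCPI K ddL X b tau n w) / AMISE K ddf n (h_AMISE K ddf n)) 1.
Proof.
apply: (cvg_in_probability_map h_GCPI_ratio_cvg).
  move=> n; have mh := measurable_h_GCPI n; apply: measurable_funM => //.
  apply: measurable_funD.
    do 3 apply: measurable_funM => //; exact: measurable_funX.
  apply: measurable_funM => //; apply: (measurableT_comp measurable_invr).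
  exact: measurable_funM.
move=> e e0; pose de := Num.min 2^-1 (e / 4) : R.
have e4 : 0 < e / 4 by rewrite divr_gt0.
exists de; first by rewrite lt_min e4 andbT invr_gt0.
near=> n => w hd; have n0 : (0 < n)%N by near: n; exact: nbhs_infty_gt.
have hA : 0 < h_AMISE K ddf n by exact: (bandwidth_gt0 K0 mu20 n0 R0).
have hG := h_GCPI_gt0 w n0.
set rho := h_GCPI K ddL X b tau n w / h_AMISE K ddf n in hd.
have rho0 : 0 < rho by rewrite divr_gt0.
have -> : h_GCPI K ddL X b tau n w = rho * h_AMISE K ddf n.
  by rewrite /rho divfK// gt_eqF.
rewrite (AMISE_ratio K0 mu20 R0 n0 rho0).
apply: (le_trans (AMISE_factor_dist _ hd)); first by rewrite /de ge_min lexx.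
have : de <= e / 4 by rewrite /de ge_min lexx orbT.
lra.
Unshelve. all: by end_near. Qed.

End OracleEquivalence.

Theorem proposition5p3 (R : realType) (d : measure_display)
  (T : measurableType d) (P : probability T R)
  (X : nat -> {RV P >-> R}) (f ddf L ddL : R -> R) (b : nat -> R)
  (X_indep : mutually_independent X)
  (X_density : forall i, has_density (X i) f)
  (L_L1 : L \in Lfun lebesgue_measure 1%E)
  (L_int : \int[lebesgue_measure]_u L u = 1)
  (L_ddL : weak_derive2 L ddL)
  (ddL_L1 : ddL \in Lfun lebesgue_measure 1%E)
  (ddL_L2 : ddL \in Lfun lebesgue_measure 2%:E)
  (G_L1 : autocorrelation ddL \in Lfun lebesgue_measure 1%E)
  (G_L2 : autocorrelation ddL \in Lfun lebesgue_measure 2%:E)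
  (f_bounded : exists M : R, forall x, `|f x| <= M)
  (f_ddf : weak_derive2 f ddf)
  (ddf_L2 : ddf \in Lfun lebesgue_measure 2%:E)
  (ddf_pos : 0 < roughness ddf)
  (b_pos : forall n, 0 < b n)
  (b_cvg0 : b @ \oo --> 0)
  (nb4 : (fun n => n%:R * b n ^+ 4) @ \oo --> +oo)
  (n2b9 : (fun n => n%:R ^+ 2 * b n ^+ 9) @ \oo --> +oo) :
  [/\ cvg_in_probability P (RU ddL X b) (roughness ddf),
      cvg_in_probability P (fun n w => RU ddL X b n w / roughness ddf) 1 &
      forall (K : R -> R) (tau : nat -> R),
        f \in Lfun lebesgue_measure 2%:E ->
        K \in Lfun lebesgue_measure 1%E ->
        K \in Lfun lebesgue_measure 2%:E ->
        \int[lebesgue_measure]_u K u = 1 ->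
        \int[lebesgue_measure]_u (u * K u) = 0 ->
        lebesgue_measure.-integrable setT (fun u : R => (u ^+ 2 * `|K u|)%:E) ->
        mu2 K != 0 ->
        (forall n, 0 < tau n) ->
        nonincreasing_seq tau ->
        tau @ \oo --> 0 ->
        (fun n => tau n / roughness ddf) @ \oo --> 0 ->
        cvg_in_probability P
          (fun n w => h_GCPI K ddL X b tau n w / h_AMISE K ddf n) 1 /\
        cvg_in_probability P
          (fun n w => AMISE K ddf n (h_GCPI K ddL X b tau n w) /
                      AMISE K ddf n (h_AMISE K ddf n)) 1].
Proof.
have [Mf fM] := f_bounded.
have l1L : L1 L by exact/Lfun1_integrable.
have l1g : L1 ddL by exact/Lfun1_integrable.
have LfunL2 (u : R -> R) : u \in Lfun lebesgue_measure 2%:E -> L2 u.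
  move=> l2u; split; last exact: (Lfun2_integrable_sqr l2u).
  by move: l2u; rewrite inE => /andP[]; rewrite inE.
have l2g := LfunL2 _ ddL_L2; have l2ddf := LfunL2 _ ddf_L2.
have l2G := LfunL2 _ G_L2.
have cRU : cvg_in_probability P (RU ddL X b) (roughness ddf).
  exact: (RU_consistent X_indep X_density fM l1L L_int l1g l2g l2ddf L_ddL f_ddf l2G).
split => //.
  have [mRU _] := cRU.
  apply: (cvg_in_probability_map cRU).
    by move=> n; apply: measurable_funM.
  move=> e e0; exists (e * roughness ddf); first by rewrite mulr_gt0.
  apply: nearW => n w h.
  have -> : RU ddL X b n w / roughness ddf - 1 = (RU ddL X b n w - roughness ddf) / roughness ddf.
    by rewrite mulrBl mulfV// gt_eqF.
  by rewrite normrM normfV (gtr0_norm ddf_pos) ler_pdivrMr.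
move=> K tau _ _ /LfunL2 l2K K_int _ _ mu20 tau_pos _ tau0 _.
have K0 := roughness_gt0 l2K K_int.
split; first exact: h_GCPI_ratio_cvg.
exact: AMISE_ratio_cvg.
Qed.
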